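(* There exist unique continuous operators $\mathcal T,\mathcal N:K((x))_1\to K((x))_1$ such that, respectively, for all $g\in K((x))_1$, $$\sum_{u\in\Phi[\mathfrak p^f]}g(x+u)=(\mathcal Tg)\circ\Phi_\eta,\qquad \prod_{u\in\Phi[\mathfrak p^f]}g(x+u)=(\mathcal Ng)\circ\Phi_\eta .$$ Moreover, $\mathcal T$ is a homomorphism of the additive group $K((x))_1$ and $\mathcal N$ is a homomorphism of the multiplicative group $K((x))_1^*$.
   Context: Basic setting. $F$ is a global function field with field of constants $\mathbb F_q$ ($q$ a power of the prime $p$), $\infty$ a fixed place of $F$ with completion $F_\infty$ and residue field $\mathbb F_\infty$, $A\subset F$ the ring of functions regular away from $\infty$, and $sgn:F_\infty\to\mathbb F_\infty$ a fixed sign function (a homomorphism $F_\infty^*\to\mathbb F_\infty^*$ that is the identity on $\mathbb F_\infty^*$ and trivial on $1$-units, extended by $sgn(0)=0$). $\tau$ is the operator $x\mapsto x^q$; $R\{\tau\}$ is the ring of skew polynomials over $R$, multiplication being composition; $\sum c_i\tau^i$ is identified with the polynomial $\sum c_ix^{q^i}$. $H^+$ is the normalizing field of $(F,\infty,sgn)$ (the finite abelian extension of $F$ generated by the coefficients of any $sgn$-normalized rank 1 Drinfeld $A$-module), $B^+$ the integral closure of $A$ in $H^+$. $\Phi:A\to B^+\{\tau\}$, $a\mapsto\Phi_a$, is a fixed $sgn$-normalized rank 1 Drinfeld module: a ring homomorphism such that $\Phi_a$ has constant coefficient $a$, $q^{\deg_\tau\Phi_a}=|A/aA|$ for $a\neq0$,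 and the leading coefficient of $\Phi_a$ is $\gamma(sgn(a))$ for a fixed $\gamma\in Gal(\mathbb F_\infty/\mathbb F_q)$. For an ideal $I$ of $A$, $\Phi[I]$ is the set of common zeros of all $\Phi_a$, $a\in I$. $\mathfrak p$ is a fixed prime ideal of $A$, $F_{\mathfrak p}$ the completion of $F$ at $\mathfrak p$, $\mathbf C_{\mathfrak p}$ the completion of an algebraic closure of $F_{\mathfrak p}$. Fix an embedding $H^+\hookrightarrow\mathbf C_{\mathfrak p}$; $K$ is the closure of $H^+$ (unramified over $F_{\mathfrak p}$), $\mathcal O$ its ring of integers, $f:=[K:F_{\mathfrak p}]$, and $\eta\in A$ is the unique element with $\mathfrak p^f=(\eta)$, $sgn(\eta)=1$. Then $\Phi_\eta(x)=\prod_{u\in\Phi[\mathfrak p^f]}(x-u)\in x\mathcal O[x]$ is monic with all zeros in the open unit ball. Function spaces. $K((x))=K[[x]][x^{-1}]$ (finite polar part); $K((x))_1$ is the ring of those Laurent series in $K((x))$ converging on the punctured open ball $B'=\{z\in\mathbf C_{\mathfrak p}:0<|z|<1\}$, with the topology of the family of seminorms $\|g\|_r=\sup\{|g(z)|:|z|=r\}$, $r\in|\mathbf C_{\mathfrak p}|\cap(0,1)$. The identities are equalities of functions on the open unit ball away from the zeros of $\Phi_\eta$, $g(x+u)$ denoting $z\mapsto g(z+u)$. $K((x))_1^*$ is the group of units of $K((x))_1$. *)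

(* Defs.v *)
From HB Require Import structures.
From mathcomp Require Import all_boot all_order all_algebra all_field.
From mathcomp Require Import all_classical all_reals all_analysis.

Set Implicit Arguments.
Unset Strict Implicit.
Unset Printing Implicit Defensive.

From mathcomp Require Import zify.

Import Order.TTheory GRing.Theory Num.Theory.
Import numFieldNormedType.Exports.

Local Open Scope classical_set_scope.
Local Open Scope ring_scope.

(* A field with a real-valued nonarchimedean absolute value [absv]; it carries
   the topology defined by [absv]. *)
HB.mixin Record Field_isNonArchimedean (R : realType) K of GRing.Field K := {
  absv : K -> R;
  absv_ge0 : forall x, 0 <= absv x;
  absv_eq0 : forall x, (absv x == 0) = (x == 0);
  absvM : {morph absv : x y / x * y};
  absvD_max : forall x y, absv (x + y) <= Num.max (absv x) (absv y)
}.

#[short(type="naFieldType")]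
HB.structure Definition NAField (R : realType) :=
  {K of GRing.Field K & Field_isNonArchimedean R K}.

Section NATheory.
Variables (R : realType) (K : naFieldType R).
Implicit Types (x y z : K) (e : R).

Lemma absv0 : absv (0 : K) = 0.
Proof. by apply/eqP; rewrite absv_eq0. Qed.

Lemma absv1 : absv (1 : K) = 1.
Proof.
have /eqP := absvM (1 : K) 1; rewrite mulr1 -subr_eq0 -{1}[absv 1]mulr1 -mulrBr.
by rewrite mulf_eq0 absv_eq0 oner_eq0 subr_eq0 => /eqP.
Qed.

Lemma absvN x : absv (- x) = absv x.
Proof.
rewrite -mulN1r absvM; suff -> : absv (-1 : K) = 1 by rewrite mul1r.
by apply/eqP; rewrite -(@eqrXn2 _ 2%N) ?absv_ge0// expr1n expr2 -absvM mulrNN mulr1 absv1.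
Qed.

Lemma absv_distC x y : absv (x - y) = absv (y - x).
Proof. by rewrite -absvN opprB. Qed.

Definition na_ball x e y : Prop := absv (x - y) < e.
Definition na_ent : set_system (K * K) := entourage_ na_ball.

Lemma na_ball_center x e : 0 < e -> na_ball x e x.
Proof. by rewrite /na_ball subrr absv0. Qed.

Lemma na_ball_sym x y e : na_ball x e y -> na_ball y e x.
Proof. by rewrite /na_ball absv_distC. Qed.

Lemma na_ball_triangle x y z e1 e2 :
  na_ball x e1 y -> na_ball y e2 z -> na_ball x (e1 + e2) z.
Proof.
rewrite /na_ball => xy yz; rewrite -(subrKA y) addrC.
apply: le_lt_trans (absvD_max _ _) _; rewrite gt_max.
have := le_lt_trans (absv_ge0 _) xy; have := le_lt_trans (absv_ge0 _) yz.
move=> e20 e10; rewrite (lt_trans yz) ?(lt_trans xy) ?ltrDl ?ltrDr//.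
Qed.

End NATheory.

#[non_forgetful_inheritance]
HB.instance Definition _ (R : realType) (K : naFieldType R) :=
  hasNbhs.Build K (nbhs_ (@na_ent R K)).

#[non_forgetful_inheritance]
HB.instance Definition _ (R : realType) (K : naFieldType R) :=
  @Nbhs_isPseudoMetric.Build R K (@na_ent R K) erefl (@na_ball R K)
    (@na_ball_center R K) (@na_ball_sym R K) (@na_ball_triangle R K) erefl.
#[non_forgetful_inheritance]
HB.instance Definition _ (R : realType) (K : naFieldType R) :=
  isPointed.Build K 0.

(* [L], via the field embedding [j], is the completion of [E] with respect to
   the absolute value [a]. *)
Definition is_completion (R : realType) (E : fieldType) (a : E -> R)
    (L : naFieldType R) (j : E -> L) : Prop :=
  [/\ forall x, absv (j x) = a x,
      dense (range j) &
      forall G : set_system L, ProperFilter G -> cauchy G -> cvg G].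

Definition is_algebraic_closure (R : realType) (E L : naFieldType R)
    (j : E -> L) : Prop :=
  [/\ GRing.closed_field_axiom L,
      forall x, algebraicOver j x &
      forall x, absv (j x) = absv x :> R].

(* Places, as normalized discrete valuations. The value at [0] is irrelevant; it
   is fixed to be [0] so that equality of valuations is equality of functions. *)
Record place (F : fieldType) := Place {
  pval :> F -> int;
  pval0 : pval 0 = 0;
  pvalM : forall x y, x != 0 -> y != 0 -> pval (x * y) = pval x + pval y;
  pvalD : forall x y, x != 0 -> y != 0 -> x + y != 0 ->
            Num.min (pval x) (pval y) <= pval (x + y);
  pval_onto : exists2 x, x != 0 & pval x = 1
}.

Definition place_abs (R : realType) (q : nat) (F : fieldType) (v : place F)
    (x : F) : R := if x == 0 then 0 else q%:R ^ (- v x).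

(* The ring of functions regular away from [oo]; with the convention above,
   [0 <= w 0] holds. *)
Definition regular_away (F : fieldType) (oo : place F) : {pred F} :=
  fun x => `[< forall w : place F, pval w <> pval oo -> 0 <= w x >].

Lemma place_ge0D (F : fieldType) (w : place F) x y :
  0 <= w x -> 0 <= w y -> 0 <= w (x + y).
Proof.
move=> x0 y0; have [->|xn] := eqVneq x 0; first by rewrite add0r.
have [->|yn] := eqVneq y 0; first by rewrite addr0.
have [->|xyn] := eqVneq (x + y) 0; first by rewrite pval0.
by apply: (le_trans _ (pvalD w xn yn xyn)); rewrite le_min x0.
Qed.

Lemma place_ge0M (F : fieldType) (w : place F) x y :
  0 <= w x -> 0 <= w y -> 0 <= w (x * y).
Proof.
move=> x0 y0; have [->|xn] := eqVneq x 0; first by rewrite mul0r pval0.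
have [->|yn] := eqVneq y 0; first by rewrite mulr0 pval0.
by rewrite pvalM// addr_ge0.
Qed.

Lemma place1 (F : fieldType) (w : place F) : w 1 = 0.
Proof.
have := pvalM w (oner_neq0 F) (oner_neq0 F).
by rewrite mulr1 => /eqP; rewrite -subr_eq0 opprD addrA subrr sub0r oppr_eq0 => /eqP.
Qed.

Lemma place_opp1 (F : fieldType) (w : place F) : w (-1) = 0.
Proof.
have n1 : (-1 : F) != 0 by rewrite oppr_eq0 oner_neq0.
have := pvalM w n1 n1; rewrite mulrNN mulr1 place1 => /esym/eqP.
by rewrite -mulr2n mulrn_eq0 => /eqP.
Qed.

Lemma regular_away_subring (F : fieldType) (oo : place F) :
  subring_closed (regular_away oo).
Proof.
split.
- by apply/asboolP => w _; rewrite place1.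
- move=> x y /asboolP xA /asboolP yA; apply/asboolP => w woo.
  apply: place_ge0D; first exact: xA.
  by rewrite -mulN1r; apply: place_ge0M; [rewrite place_opp1|exact: yA].
- move=> x y /asboolP xA /asboolP yA; apply/asboolP => w woo.
  by apply: place_ge0M; [exact: xA|exact: yA].
Qed.

HB.instance Definition _ (F : fieldType) (oo : place F) :=
  GRing.isSubringClosed.Build F (regular_away oo) (regular_away_subring oo).

Record ringA (F : fieldType) (oo : place F) :=
  RingA { ringA_val :> F; _ : ringA_val \in regular_away oo }.

HB.instance Definition _ (F : fieldType) (oo : place F) :=
  [isSub for @ringA_val F oo].
HB.instance Definition _ (F : fieldType) (oo : place F) :=
  [Choice of ringA oo by <:].
HB.instance Definition _ (F : fieldType) (oo : place F) :=
  [SubChoice_isSubComNzRing of ringA oo by <:].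

Section Ideals.
Variable A : comNzRingType.

Definition ideal_mul (I J : set A) : set A :=
  [set x | exists2 s : seq (A * A),
     (forall c, c \in s -> I c.1 /\ J c.2) & x = \sum_(c <- s) c.1 * c.2].

Definition ideal_exp (I : set A) (n : nat) : set A :=
  iter n (ideal_mul I) setT.

Definition principal (a : A) : set A := [set x | exists b, x = b * a].

(* The quotient [A / I], as a set of cosets. *)
Definition residue_classes (I : set A) : set (set A) :=
  range (fun x : A => [set y | I (y - x)]).

End Ideals.

(* [v] is the normalized valuation attached to the prime ideal [P] of [A]. *)
Definition is_adic_place (F : fieldType) (oo : place F) (P : set (ringA oo))
    (v : place F) : Prop :=
  forall (a : ringA oo) (n : nat), a != 0 -> n%:Z <= v a <-> ideal_exp P n a.

Section SkewPoly.
Variables (q : nat) (L : fieldType).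
Implicit Types c d : {poly L}.

(* An element [\sum_i c_i tau^i] of [L{tau}] is encoded by the polynomial with
   coefficients [c_i]; [tau a = a ^ q tau]. *)
Definition tau_mul c d : {poly L} :=
  \poly_(k < (size c + size d)%N) \sum_(i < k.+1) c`_i * d`_(k - i) ^+ (q ^ i).

Definition tau_poly c : {poly L} := \sum_(i < size c) c`_i *: 'X^(q ^ i).

End SkewPoly.

Definition constF (Fq : finFieldType) (F : fieldExtType {fraction {poly Fq}})
  (c : Fq) : F := (tofrac c%:P)%:A.

Definition exact_constants (Fq : finFieldType)
    (F : fieldExtType {fraction {poly Fq}}) : Prop :=
  forall x : F, algebraicOver (@constF Fq F) x -> exists c, x = constF F c.

(* [k] is the residue field of [L]; the reduction map [red] is irrelevant outside
   the valuation ring. *)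
Record is_residue_map (R : realType) (L : naFieldType R) (k : fieldType)
    (red : L -> k) : Prop := {
  red1 : red 1 = 1;
  redD : forall x y, absv x <= 1 :> R -> absv y <= 1 :> R ->
           red (x + y) = red x + red y;
  redM : forall x y, absv x <= 1 :> R -> absv y <= 1 :> R ->
           red (x * y) = red x * red y;
  red_eq0 : forall x, absv x <= 1 :> R -> red x = 0 <-> absv x < 1 :> R;
  red_onto : forall c, exists2 x, absv x <= 1 :> R & red x = c
}.

(* [teich] identifies the residue field [k] with a subfield of [L]. *)
Definition is_residue_section (R : realType) (L : naFieldType R) (k : fieldType)
    (red : L -> k) (teich : k -> L) : Prop :=
  forall c, absv (teich c) <= 1 :> R /\ red (teich c) = c.

Record is_sign_function (R : realType) (L : naFieldType R) (k : fieldType)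
    (teich : k -> L) (sgn : L -> k) : Prop := {
  sgn0 : sgn 0 = 0;
  sgn_neq0 : forall x, x != 0 -> sgn x != 0;
  sgnM : forall x y, x != 0 -> y != 0 -> sgn (x * y) = sgn x * sgn y;
  sgn_teich : forall c, c != 0 -> sgn (teich c) = c;
  sgn_1unit : forall x, absv (x - 1) < 1 :> R -> sgn x = 1
}.

(* Here [sg] is the twisted sign [gamma \o sgn] restricted to [A], with values in
   [H]. The degree in [tau] of [c] is [(size c).-1]. *)
Record is_sgn_normalized (q : nat) (F : fieldType) (oo : place F)
    (H : fieldExtType F) (sg : ringA oo -> H) (Phi : ringA oo -> {poly H})
    : Prop := {
  Phi_integral : forall a i,
    integralOver (fun b : ringA oo => (b : F)%:A : H) (Phi a)`_i;
  Phi1 : Phi 1 = 1;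
  PhiD : forall a b, Phi (a + b) = Phi a + Phi b;
  PhiM : forall a b, Phi (a * b) = tau_mul q (Phi a) (Phi b);
  Phi_coef0 : forall a, (Phi a)`_0 = (a : F)%:A;
  Phi_rank1 : forall a, a != 0 ->
    (residue_classes (principal a) #= `I_(q ^ (size (Phi a)).-1))%card;
  Phi_lead : forall a, a != 0 -> lead_coef (Phi a) = sg a
}.

(* The common zeros in [C] of the [Phi_a], [a \in I]. *)
Definition torsion (q : nat) (A : Type) (H C : fieldType) (j : H -> C)
    (Phi : A -> {poly H}) (I : set A) : set C :=
  [set z | forall a, I a -> root (map_poly j (tau_poly q (Phi a))) z].

(* [iL : L -> C] has degree [n] over [iE : E -> C], [E] and [L] being identified
   with subfields of [C]. *)
Definition has_degree (E L C : fieldType) (iE : E -> C) (iL : L -> C)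
    (n : nat) : Prop :=
  exists e : 'I_n -> L, forall x : L,
    exists! c : {ffun 'I_n -> E}, iL x = \sum_(i < n) iE (c i) * iL (e i).

Section LaurentSeries.
Variable K : nzRingType.
Implicit Types (g h : int -> K) (A B : nat).

(* Laurent series are given by their coefficients. The sum is finite when [g] and
   [h] vanish at all sufficiently negative indices. *)
Definition lmul g h : int -> K :=
  fun n => \sum_(k \in [set: int]) g k * h (n - k).

Definition lone : int -> K := fun n => (n == 0)%:R.

Definition polar_bound A g := forall k : int, k < - A%:Z -> g k = 0.

Definition lshift A g : nat -> K := fun m => g (m%:Z - A%:Z).

Definition conv (u v : nat -> K) : nat -> K :=
  fun m => \sum_(i < m.+1) u i * v (m - i)%N.

Lemma polar_bound_le A B g : (A <= B)%N -> polar_bound A g -> polar_bound B g.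
Proof. by move=> AB gA k kB; apply: gA; lia. Qed.

Lemma polar_boundP g :
  (exists N : int, forall k, k < N -> g k = 0) <-> exists A, polar_bound A g.
Proof.
split=> [[N gN]|[A gA]]; last by exists (- A%:Z).
by exists `|N|%N => k kN; apply: gN; lia.
Qed.

Lemma lshift_inj A g h : polar_bound A g -> polar_bound A h ->
  lshift A g =1 lshift A h -> g = h.
Proof.
move=> gA hA gh; apply/funext => k.
have [kA|Ak] := ltP k (- A%:Z); first by rewrite gA// hA.
have := gh `|(k + A%:Z)%R|%N; rewrite /lshift gez0_abs ?addrK//; lia.
Qed.

Lemma lmulE A B g h n : polar_bound A g -> polar_bound B h ->
  lmul g h (n%:Z - (A + B)%:Z) = conv (lshift A g) (lshift B h) n.
Proof.
move=> gA hB; rewrite /lmul /conv.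
pose s := [seq (i%:Z - A%:Z) | i <- iota 0 n.+1].
have su : uniq s by rewrite map_inj_uniq ?iota_uniq// => i j; lia.
rewrite -(fsbig_widen [set` s] setT) //; last first.
  move=> k [_ /= ks]; have [kA|Ak] := ltP k (- A%:Z).
    by rewrite /= gA// mul0r.
  rewrite /= hB ?mulr0// ltNge; apply/negP => kn; apply: ks.
  apply/mapP; exists `|(k + A%:Z)%R|%N; last by lia.
  by rewrite mem_iota; lia.
rewrite -fsbig_seq// /s big_map -[iota 0 n.+1]/(index_iota 0 n.+1) big_mkord.
apply: eq_bigr => i _; rewrite /lshift; congr (_ * h _).
by have := ltn_ord i; lia.
Qed.

Lemma lmul_polar A B g h : polar_bound A g -> polar_bound B h ->
  polar_bound (A + B) (lmul g h).
Proof.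
move=> gA hB n nAB; rewrite /lmul fsbig1// => k _.
have [kA|Ak] := ltP k (- A%:Z); first by rewrite gA// mul0r.
by rewrite hB ?mulr0//; lia.
Qed.

Lemma lshift_lmul A B g h : polar_bound A g -> polar_bound B h ->
  lshift (A + B) (lmul g h) = conv (lshift A g) (lshift B h).
Proof. by move=> gA hB; apply/funext => n; exact: lmulE. Qed.

Lemma lone_polar : polar_bound 0 lone.
Proof. by move=> k k0; rewrite /lone; case: eqP => //; lia. Qed.

Lemma conv_poly N u v m : (m < N)%N ->
  conv u v m = (\poly_(i < N) u i * \poly_(i < N) v i)`_m.
Proof.
move=> mN; rewrite coefM; apply: eq_bigr => i _; rewrite !coef_poly.
by have := ltn_ord i; rewrite ltnS => im; rewrite !ifT//; lia.
Qed.

Lemma eq_conv u u' v v' m : (forall i, (i <= m)%N -> u i = u' i) ->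
  (forall i, (i <= m)%N -> v i = v' i) -> conv u v m = conv u' v' m.
Proof.
move=> uu vv; apply: eq_bigr => i _; rewrite uu ?vv ?leq_subr//.
by rewrite -ltnS.
Qed.

Lemma convA u v w : conv u (conv v w) = conv (conv u v) w.
Proof.
apply/funext => m; pose P (u : nat -> K) := \poly_(i < m.+1) u i.
have Pc u' i : (i <= m)%N -> u' i = (P u')`_i.
  by move=> im; rewrite coef_poly ltnS im.
have Pconv u' v' i : (i <= m)%N -> conv u' v' i = (P u' * P v')`_i.
  by move=> im; rewrite (@conv_poly m.+1).
rewrite (@eq_conv _ (fun i => (P u)`_i) _ (fun i => (P v * P w)`_i)); last 2 first.
- by move=> i; exact: Pc.
- by move=> i; exact: Pconv.
rewrite [RHS](@eq_conv _ (fun i => (P u * P v)`_i) _ (fun i => (P w)`_i)); last 2 first.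
- by move=> i; exact: Pconv.
- by move=> i; exact: Pc.
by rewrite /conv -!coefM mulrA.
Qed.

Lemma lmulA g h k A B C : polar_bound A g -> polar_bound B h ->
  polar_bound C k -> lmul g (lmul h k) = lmul (lmul g h) k.
Proof.
move=> gA hB kC.
apply: (@lshift_inj (A + (B + C))).
- by do !apply: lmul_polar.
- by rewrite addnA; do !apply: lmul_polar.
move=> m; rewrite lshift_lmul//; last exact: lmul_polar.
rewrite lshift_lmul// addnA lshift_lmul//; last exact: lmul_polar.
by rewrite lshift_lmul// convA.
Qed.

Lemma lmul1 g A : polar_bound A g -> lmul lone g = g.
Proof.
move=> gA; apply: (@lshift_inj A) => //.
  by rewrite -[A]add0n; apply: lmul_polar => //; exact: lone_polar.
move=> m; rewrite -{1}[A]add0n lshift_lmul//; last exact: lone_polar.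
rewrite /conv big_ord_recl /lshift /lone /= mul1r subn0.
by rewrite big1 ?addr0// => i _; rewrite mul0r.
Qed.

Lemma lmulDl g g' h A B : polar_bound A g -> polar_bound A g' ->
  polar_bound B h -> lmul (g + g') h = lmul g h + lmul g' h.
Proof.
move=> gA gA' hB.
have ggA : polar_bound A (g + g').
  by move=> k kA; rewrite /GRing.add /= gA// gA'// addr0.
apply: (@lshift_inj (A + B)); first exact: lmul_polar.
  by move=> k kAB; rewrite /GRing.add /= !(lmul_polar (A := A) (B := B))// addr0.
move=> m; rewrite lshift_lmul//.
transitivity (conv (lshift A g) (lshift B h) m + conv (lshift A g') (lshift B h) m).
  by rewrite /conv -big_split /=; apply: eq_bigr => i _; rewrite -mulrDl.
by rewrite -!lshift_lmul.
Qed.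

End LaurentSeries.

Lemma lmulC (K : comNzRingType) (g h : int -> K) A B : polar_bound A g ->
  polar_bound B h -> lmul g h = lmul h g.
Proof.
move=> gA hB; apply: (@lshift_inj _ (A + B)); first exact: lmul_polar.
  by rewrite addnC; exact: lmul_polar.
move=> m; rewrite lshift_lmul// addnC lshift_lmul//.
by rewrite !(@conv_poly _ m.+1)// mulrC.
Qed.

Section NAConvergence.
Variables (R : realType) (C : naFieldType R).
Implicit Types (x y l : C) (u v : nat -> C) (e : R).

Lemma na_cvgP u l : u @ \oo --> l <->
  forall e, 0 < e -> exists N, forall n, (N <= n)%N -> absv (l - u n) < e.
Proof.
split=> [/cvg_ball ul e /ul[N _ Nu]|ul]; first by exists N => n /Nu.
by apply/cvg_ballP => e /ul[N Nu]; exists N.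
Qed.

Lemma absvD_le x y e : absv x <= e -> absv y <= e -> absv (x + y) <= e.
Proof. by move=> xe ye; rewrite (le_trans (absvD_max _ _))// ge_max xe. Qed.

Lemma absv_sum_le (I : Type) (r : seq I) (P : pred I) (F : I -> C) e : 0 <= e ->
  (forall i, P i -> absv (F i) <= e) -> absv (\sum_(i <- r | P i) F i) <= e.
Proof.
move=> e0 Fe; apply: (big_ind (fun x : C => absv x <= e)) => //.
  by rewrite absv0.
by move=> x y; exact: absvD_le.
Qed.

Lemma na_cvgD u v l l' : u @ \oo --> l -> v @ \oo --> l' ->
  (fun n => u n + v n) @ \oo --> l + l'.
Proof.
move=> /na_cvgP ul /na_cvgP vl'; apply/na_cvgP => e e0.
have [N Nu] := ul _ e0; have [N' Nv] := vl' _ e0.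
exists (maxn N N') => n; rewrite geq_max => /andP[/Nu ne /Nv n'e].
rewrite opprD addrACA (le_lt_trans (absvD_max _ _))// gt_max ne.
exact: n'e.
Qed.

Lemma na_cvgN u l : u @ \oo --> l -> (fun n => - u n) @ \oo --> - l.
Proof.
move=> /na_cvgP ul; apply/na_cvgP => e /ul[N Nu]; exists N => n /Nu.
by rewrite -opprD absvN.
Qed.

Lemma na_cvg_term u : cvg (series u @ \oo) ->
  forall e, 0 < e -> exists N, forall n, (N <= n)%N -> absv (u n) < e.
Proof.
move=> /na_cvgP ul e /ul[N Nu]; exists N => n Nn.
have -> : u n = (lim (series u @ \oo) - series u n) -
                (lim (series u @ \oo) - series u n.+1).
  rewrite opprB [X in _ = X]addrC addrA subrK.
  by rewrite /series /= big_nat_recr//= addrAC subrr add0r.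
rewrite (le_lt_trans (absvD_max _ _))// gt_max absvN !Nu// ltnW//.
Qed.

Lemma na_bounded u : cvg (series u @ \oo) ->
  exists2 M : R, 0 < M & forall n, absv (u n) <= M.
Proof.
move=> /na_cvg_term/(_ 1 ltr01)[N Nu].
exists (1 + \sum_(i < N) absv (u i)).
  by rewrite ltr_wpDr// sumr_ge0// => i _; exact: absv_ge0.
move=> n; have [nN|/Nu/ltW u1] := ltnP n N; last first.
  by rewrite (le_trans u1)// lerDl sumr_ge0// => i _; exact: absv_ge0.
rewrite (bigD1 (Ordinal nN))//= addrCA lerDl addr_ge0//.
by rewrite sumr_ge0// => i _; exact: absv_ge0.
Qed.

Lemma na_cvg_conv u v : cvg (series u @ \oo) -> cvg (series v @ \oo) ->
  cvg (series (conv u v) @ \oo).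
Proof.
move=> cu cv; set l := lim (series u @ \oo); set l' := lim (series v @ \oo).
apply: (cvgP (l * l')); apply/na_cvgP => e e0.
have [Mu Mu0 uM] := na_bounded cu; have [Mv Mv0 vM] := na_bounded cv.
pose M := Mu + Mv + absv l'.
have l'0 : 0 <= absv l' := absv_ge0 _.
have M0 : 0 < M by rewrite /M -addrA ltr_wpDr// addr_ge0// ltW.
have {}uM n : absv (u n) <= M.
  by rewrite (le_trans (uM n))// /M -addrA lerDl addr_ge0// ltW.
have {}vM n : absv (v n) <= M.
  by rewrite (le_trans (vM n))// /M addrAC lerDr addr_ge0// ltW.
have l'M : absv l' <= M by rewrite /M lerDr addr_ge0// ltW.
have e20 : 0 < e / 2 by rewrite divr_gt0.
pose d := e / 2 / M; have d0 : 0 < d by rewrite divr_gt0.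
have dM x y : absv x <= d -> absv y <= M -> absv (x * y) <= e / 2.
  move=> xd yM; rewrite absvM (le_trans (ler_pM _ _ xd yM)) ?absv_ge0//.
  by rewrite /d divfK// gt_eqF.
have [N1 uN] := na_cvg_term cu d0; have [N2 vN] := na_cvg_term cv d0.
have [N3 lN] := (na_cvgP _ _).1 cu _ d0; have [N4 lN'] := (na_cvgP _ _).1 cv _ d0.
pose N := (N1 + N2 + N3 + N4)%N.
exists (N.*2) => n Nn; apply: (@le_lt_trans _ _ (e / 2)); last first.
  by rewrite ltr_pdivrMr// ltr_pMr// ltr1n.
have -> : l * l' - series (conv u v) n = (l - series u n) * l' +
    ((l' - series v n) * series u n +
     (series u n * series v n - series (conv u v) n)).
  by rewrite !mulrBl [l' * _]mulrC [series v n * _]mulrC !addrA subrK subrK.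
apply: absvD_le; first by apply: dM => //; apply/ltW/lN; lia.
apply: absvD_le.
  apply: dM; first by apply/ltW/lN'; lia.
  by apply: absv_sum_le => //; exact: ltW.
pose P (u : nat -> C) := \poly_(i < n) u i.
have Ps w : series w n = (P w).[1].
  rewrite (horner_coef_wide _ (size_poly _ _)) /series /= big_mkord.
  by apply: eq_bigr => i _; rewrite expr1n mulr1 coef_poly ltn_ord.
have PQ : (size (P u * P v)%R <= n + n)%N.
  rewrite (leq_trans (size_polyMleq _ _))// (leq_trans (leq_pred _))//.
  by rewrite leq_add// size_poly.
rewrite !Ps -hornerM (horner_coef_wide _ PQ) -Ps /series /= big_mkord big_split_ord /=.
rewrite addrAC -sumrB big1 ?add0r; last first.
  by move=> i _; rewrite expr1n mulr1 (@conv_poly _ n)// subrr.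
apply: absv_sum_le => [|i _]; first exact: ltW.
rewrite expr1n mulr1 coefM; apply: absv_sum_le => [|j _]; first exact: ltW.
rewrite !coef_poly; case: ifP => jn; last by rewrite mul0r absv0 ltW.
case: ifP => kn; last by rewrite mulr0 absv0 ltW.
have [jN|Nj] := ltnP j N.
  by rewrite mulrC; apply: dM => //; apply/ltW/vN; lia.
by apply: dM => //; apply/ltW/uN; lia.
Qed.

End NAConvergence.

Section LaurentEval.
Variables (R : realType) (K : fieldType) (C : naFieldType R).
Variable iK : {rmorphism K -> C}.
Implicit Types (g h : int -> K) (z : C) (A B n : nat).

(* The terms of index [- n, ..., n - 1] of the series at [z]. *)
Definition lpsum g z n : C :=
  \sum_(0 <= k < n.*2) iK (g (k%:Z - n%:Z)) * z ^ (k%:Z - n%:Z).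

Definition leval g z : C := lim (lpsum g z @ \oo).

Definition lconvergent g : Prop :=
  (exists N : int, forall k, k < N -> g k = 0) /\
  (forall z : C, 0 < absv z < 1 -> cvg (lpsum g z @ \oo)).

Definition lterm A g z : nat -> C :=
  fun m => iK (lshift A g m) * z ^ (m%:Z - A%:Z).

Lemma lpsum_series A g z n : polar_bound A g ->
  lpsum g z (n + A) = series (lterm A g z) (n + A.*2).
Proof.
move=> gA; rewrite /lpsum /series /= (@big_cat_nat _ _ _ n)//=; last by lia.
rewrite big_nat_cond big1 ?add0r; last first.
  by move=> i /andP[/andP[_ ni] _]; rewrite gA ?rmorph0 ?mul0r//; lia.
rewrite -{1}[n]add0n big_addn.
rewrite (_ : (_ - n = n + A.*2)%N); last by lia.
apply: eq_bigr => i _; rewrite /lterm /lshift.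
by rewrite (_ : _ - _ = i%:Z - A%:Z :> int)//; lia.
Qed.

Lemma lpsum_cvg A g z (l : C) : polar_bound A g ->
  (lpsum g z @ \oo --> l) = (series (lterm A g z) @ \oo --> l).
Proof.
move=> gA; rewrite -(cvg_shiftn A) -[RHS](cvg_shiftn A.*2).
by congr (_ @ \oo --> l); apply/funext => n; rewrite /= lpsum_series.
Qed.

Lemma lpsum_is_cvg A g z : polar_bound A g ->
  cvg (lpsum g z @ \oo) <-> cvg (series (lterm A g z) @ \oo).
Proof.
move=> gA; split => h.
  by apply: (cvgP (lim (lpsum g z @ \oo))); rewrite -(lpsum_cvg z _ gA).
by apply: (cvgP (lim (series (lterm A g z) @ \oo))); rewrite (lpsum_cvg z _ gA).
Qed.

Lemma lconvergent0 : lconvergent 0.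
Proof.
split=> [|z _]; first by exists 0.
apply: (cvgP (0 : C)); apply/na_cvgP => e e0; exists 0 => n _.
by rewrite /lpsum big1 ?subr0 ?absv0// => i _; rewrite rmorph0 mul0r.
Qed.

Lemma lconvergentB g h : lconvergent g -> lconvergent h -> lconvergent (g - h).
Proof.
move=> [[N gN] gc] [[M hM] hc]; split => [|z z1].
  exists (Num.min N M) => k; rewrite lt_min => /andP[kN kM].
  by rewrite -[LHS]/(g k - h k) gN// hM// subr0.
rewrite (_ : lpsum (g - h) z = fun n => lpsum g z n + - lpsum h z n).
  exact: cvgP (na_cvgD (gc _ z1) (na_cvgN (hc _ z1))).
apply/funext => n; rewrite /lpsum -sumrN -big_split.
by apply: eq_bigr => i _; rewrite /= -mulrBl -rmorphB.
Qed.

Lemma lconvergent1 : lconvergent (lone K).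
Proof.
split=> [|z _]; first by apply/polar_boundP; exists 0%N; exact: lone_polar.
apply/(lpsum_is_cvg _ (@lone_polar K)); apply: (cvgP (1 : C)).
apply/na_cvgP => e e0; exists 1%N => -[//|n] _.
rewrite /series /= big_nat_recl//= big1 ?addr0.
  by rewrite /lterm /lshift /lone /= rmorph1 mul1r expr0z subrr absv0.
by move=> i _; rewrite /lterm /lshift /lone /= rmorph0 mul0r.
Qed.

Lemma lconvergentM g h :
  lconvergent g -> lconvergent h -> lconvergent (lmul g h).
Proof.
move=> [/polar_boundP[A gA] gc] [/polar_boundP[B hB] hc]; split => [|z z1].
  by apply/polar_boundP; exists (A + B)%N; exact: lmul_polar.
have z0 : z != 0 by case/andP : z1; rewrite lt_neqAle eq_sym absv_eq0 => /andP[].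
apply/(lpsum_is_cvg _ (lmul_polar gA hB)).
rewrite (_ : lterm _ _ _ = conv (lterm A g z) (lterm B h z)).
  apply: na_cvg_conv; [exact/(lpsum_is_cvg z gA)/gc|exact/(lpsum_is_cvg z hB)/hc].
apply/funext => m; rewrite /lterm lshift_lmul// /conv rmorph_sum mulr_suml.
apply: eq_bigr => i _; rewrite rmorphM/= mulrACA; congr (_ * _).
by rewrite -expfzDr//; congr (z ^ _); have := ltn_ord i; lia.
Qed.

Definition lconvergent_pred : {pred int -> K} := fun g => `[< lconvergent g >].

Lemma lconvergent_zmod : zmod_closed lconvergent_pred.
Proof.
split=> [|g h /asboolP gc /asboolP hc]; apply/asboolP.
  exact: lconvergent0.
exact: lconvergentB.
Qed.

HB.instance Definition _ :=
  GRing.isZmodClosed.Build (int -> K) lconvergent_pred lconvergent_zmod.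

(* The Laurent series over [K] with finite polar part which converge for
   [0 < |z| < 1], [z \in C]. *)
Record laurent := Laurent { lcoef :> int -> K; _ : lcoef \in lconvergent_pred }.

HB.instance Definition _ := [isSub for lcoef].
HB.instance Definition _ := [Choice of laurent by <:].
HB.instance Definition _ := [SubChoice_isSubZmodule of laurent by <:].

Implicit Types a b c : laurent.

Lemma laurentP a : lconvergent a.
Proof. by case: a => g /= /asboolP. Qed.

Lemma laurent_polar a : exists A, polar_bound A a.
Proof. by have [/polar_boundP] := laurentP a. Qed.

Definition laurent_mul a b : laurent :=
  Laurent (asboolT (lconvergentM (laurentP a) (laurentP b))).

Definition laurent_one : laurent := Laurent (asboolT lconvergent1).

Lemma laurent_mulA : associative laurent_mul.
Proof.
move=> a b c; apply/val_inj => /=.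
have [[[A aA] [B bB]] [D cD]] := (laurent_polar a, laurent_polar b, laurent_polar c).
exact: lmulA aA bB cD.
Qed.

Lemma laurent_mulC : commutative laurent_mul.
Proof.
move=> a b; apply/val_inj => /=.
have [[A aA] [B bB]] := (laurent_polar a, laurent_polar b).
exact: lmulC aA bB.
Qed.

Lemma laurent_mul1 : left_id laurent_one laurent_mul.
Proof.
by move=> a; apply/val_inj => /=; have [A aA] := laurent_polar a; exact: lmul1 aA.
Qed.

Lemma laurent_mulDl : left_distributive laurent_mul +%R.
Proof.
move=> a b c; apply/val_inj => /=.
have [[[A aA] [B bB]] [D cD]] := (laurent_polar a, laurent_polar b, laurent_polar c).
apply: (@lmulDl _ _ _ _ (A + B) D) => //.
  by apply: polar_bound_le aA; lia.
by apply: polar_bound_le bB; lia.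
Qed.

Lemma laurent_one_neq0 : laurent_one != 0.
Proof.
apply/eqP => /(congr1 (fun a : laurent => a 0)) /eqP.
by rewrite /= /lone eqxx oner_eq0.
Qed.

HB.instance Definition _ := GRing.Zmodule_isComNzRing.Build laurent
  laurent_mulA laurent_mulC laurent_mul1 laurent_mulDl laurent_one_neq0.

Definition laurent_unit : {pred laurent} := fun a => `[< exists b, b * a = 1 >].

Definition laurent_inv a : laurent :=
  if pselect (exists b, b * a = 1) is left ab then projT1 (cid ab) else a.

Lemma laurent_mulV : {in laurent_unit, left_inverse 1 laurent_inv *%R}.
Proof.
move=> a /asboolP ab; rewrite /laurent_inv.
by case: pselect => // ab'; case: cid.
Qed.

Lemma laurent_unitP a b : b * a = 1 -> laurent_unit a.
Proof. by move=> ab; apply/asboolP; exists b. Qed.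

Lemma laurent_inv_out : {in [predC laurent_unit], laurent_inv =1 id}.
Proof.
move=> a; rewrite inE /= => /asboolPn ab; rewrite /laurent_inv.
by case: pselect.
Qed.

HB.instance Definition _ := GRing.ComNzRing_hasMulInverse.Build laurent
  laurent_mulV laurent_unitP laurent_inv_out.

Definition lseminorm (r : R) a : R :=
  sup [set absv (leval a z) | z in [set z : C | absv z = r]].

(* The subbase of the topology of the family of seminorms [lseminorm r], [r] in
   the value group of [C] and [0 < r < 1]. *)
Definition lseminorm_ball : set (set laurent) :=
  [set U | exists r : R, [/\ 0 < r < 1, exists z : C, absv z = r &
    exists b (e : R), U = [set a | lseminorm r (a - b) < e]]].

HB.instance Definition _ :=
  isSubBaseTopological.Build laurent lseminorm_ball id.

(* Here [V] is the (finite) zero set of [psi]. *)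
Definition is_trace_operator (psi : {poly C}) (V : set C)
    (T : laurent -> laurent) : Prop :=
  forall (g : laurent) (z : C), absv z < 1 -> psi.[z] != 0 ->
    \sum_(u \in V) leval g (z + u) = leval (T g) psi.[z].

Definition is_norm_operator (psi : {poly C}) (V : set C)
    (N : laurent -> laurent) : Prop :=
  forall (g : laurent) (z : C), absv z < 1 -> psi.[z] != 0 ->
    \big[*%R/1]_(u \in V) leval g (z + u) = leval (N g) psi.[z].

End LaurentEval.

(* Main.v *)
(* Write [psi] for [Phi_eta], [V] for its zero set and [Q] for its degree; [psi]
   is additive, hence invariant under translation by [V]. Division by the monic
   polynomial [psi (x) - y] turns every [g] in [K((x))_1] into
   [g (x) = \sum_(j < Q) x ^ j * c_j (psi x)] with [c_j] in [K((x))_1]. Expanding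
   [x ^ i * g] in this way for [i < Q] gives a matrix over [K((x))_1] whose
   value at [psi z] is diagonalized, by the Vandermonde matrix of the [z + u],
   into the values [g (z + u)]: the trace operator is its trace and the norm
   operator its determinant. Uniqueness follows from the surjectivity of [psi]
   on the open ball. That the zeros of [psi] lie in the open ball is the
   rank 1 property: if [eta^2 m = 0 != eta m] with [m] in the open ball, then
   some multiple of [m] generates all of [V] over [A]. *)

From HB Require Import structures.
Require Import Defs.
From mathcomp Require Import all_boot all_order all_algebra all_field.
From mathcomp Require Import all_classical all_reals all_analysis.
From mathcomp Require Import finmap zify ring.

Set Implicit Arguments.
Unset Strict Implicit.
Unset Printing Implicit Defensive.

Import Order.TTheory GRing.Theory Num.Theory.
Import numFieldNormedType.Exports.

Local Open Scope classical_set_scope.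
Local Open Scope ring_scope.

(** * Series over a complete nonarchimedean field *)

(** The zeros [u] lie in [C], so a sum or product over [V] is not visibly a series over [K].
    Division by psi (x) - y involves only coefficients of [psi], which lie in [K], so the matrix has
    its entries over [K] and no Galois descent is needed; the Vandermonde matrix enters only after
    evaluation. Division does not increase the Gauss norm in which x has weight r and y has weight r
    ^ Q, provided r bounds the zeros; this makes the c_j converge. Poles are reached through 1 / x =
    (psi x / x) / psi x. [C] is the completion of an algebraically closed field and is not assumed
    to be algebraically closed itself: zeros and small preimages are found before completing, then
    summed by additivity. The nonzero zeros of [psi] multiply to eta up to sign, so one of them, u,
    lies in the open ball. The annihilator of u may be larger than eta A, and u then generates only
    part of [V]; this is why a point m with eta m = u is needed. *)

Lemma big_triangle (V : nmodType) (F : nat -> nat -> V) n :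
  \sum_(m < n) \sum_(i < m.+1) F i (m - i)%N = \sum_(i < n) \sum_(j < n - i) F i j.
Proof.
elim: n => [|n IH]; first by rewrite !big_ord0.
rewrite big_ord_recr/= IH [RHS]big_ord_recr /= subSnn big_ord1 big_ord_recr /= subnn.
rewrite addrA; congr (_ + _); rewrite -big_split /=.
by apply: eq_bigr => i _; rewrite subSn ?big_ord_recr// ltnW.
Qed.

Lemma horner_prod_XsubC (S : comNzRingType) (s : seq S) (z : S) :
  (\prod_(u <- s) ('X - u%:P)).[z] = \prod_(u <- s) (z - u).
Proof. by rewrite horner_prod; apply: eq_bigr => u _; rewrite hornerXsubC. Qed.

Lemma prod_seq_le (R : realDomainType) (I : eqType) (s : seq I) (F : I -> R) (x : R) :
  (forall i, i \in s -> 0 <= F i <= x) -> \prod_(i <- s) F i <= x ^+ size s.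
Proof.
elim: s => [|i s IH] Fx; first by rewrite big_nil.
have /andP[Fi0 Fix] := Fx i (mem_head i s).
have {}Fx j : j \in s -> 0 <= F j <= x by move=> js; rewrite Fx// in_cons js orbT.
rewrite big_cons exprS ler_pM ?IH// big_seq prodr_ge0// => j js.
by case/andP : (Fx j js).
Qed.

Section NAField.
Variables (R : realType) (C : naFieldType R).
Implicit Types (x y z l : C) (u v : nat -> C) (e : R).

Lemma absvX x n : absv (x ^+ n) = absv x ^+ n.
Proof. by elim: n => [|n IH]; rewrite ?expr0 ?absv1// !exprS absvM IH. Qed.

Lemma absvV x : absv x^-1 = (absv x)^-1.
Proof.
have [->|x0] := eqVneq x 0; first by rewrite invr0 absv0 invr0.
have ax0 : absv x != 0 by rewrite absv_eq0.
by apply: (mulfI ax0); rewrite -absvM !mulfV// absv1.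
Qed.

Lemma absvXz x (n : int) : absv (x ^ n) = absv x ^ n.
Proof. by case: n => n; rewrite ?NegzE -?exprnN -?exprnP ?absvV absvX. Qed.

Lemma absv_prod (I : Type) (r : seq I) (P : pred I) (F : I -> C) :
  absv (\prod_(i <- r | P i) F i) = \prod_(i <- r | P i) absv (F i).
Proof. exact: (big_morph _ (@absvM R C) (absv1 C)). Qed.

Lemma absv_gt0 x : (0 < absv x) = (x != 0).
Proof. by rewrite lt_neqAle absv_ge0 andbT eq_sym absv_eq0. Qed.

Lemma absv_neq0 x : 0 < absv x -> x != 0.
Proof. by rewrite absv_gt0. Qed.

Lemma absvDl x y : absv y < absv x -> absv (x + y) = absv x.
Proof.
move=> yx; apply/le_anti/andP; split.
  by apply: absvD_le => //; exact: ltW.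
rewrite leNgt; apply/negP => h.
by have := absvD_max (x + y) (- y); rewrite absvN addrK leNgt gt_max h yx.
Qed.

Lemma absv_lt_max x y e : absv x < e -> absv y < e -> absv (x + y) < e.
Proof. by move=> xe ye; rewrite (le_lt_trans (absvD_max _ _))// gt_max xe. Qed.

Lemma absv_lt_maxB x y e : absv x < e -> absv y < e -> absv (x - y) < e.
Proof. by move=> xe ye; rewrite absv_lt_max// absvN. Qed.

Lemma absv_sum_lt (I : eqType) (r : seq I) (F : I -> C) e : 0 < e ->
  (forall i, i \in r -> absv (F i) < e) -> absv (\sum_(i <- r) F i) < e.
Proof.
move=> e0 Fe; rewrite big_seq; apply: (big_ind (fun x : C => absv x < e)) => //.
  by rewrite absv0.
by move=> x y; exact: absv_lt_max.
Qed.

Lemma absv_le0 x : (forall e, 0 < e -> absv x <= e) -> x = 0.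
Proof.
move=> h; apply/eqP; rewrite -absv_eq0 eq_le absv_ge0 andbT.
by apply/ler_addgt0Pr => e e0; rewrite add0r h.
Qed.

(** Used for the continuity of the norm operator. As [d <= M], the bound [M] on the [G i] holds for
    the [F i] as well, and the factors can be exchanged one at a time. *)
Lemma absv_prodB (I : eqType) (s : seq I) (F G : I -> C) (M d : R) :
  1 <= M -> 0 <= d -> d <= M -> (forall i, i \in s -> absv (G i) <= M) ->
  (forall i, i \in s -> absv (F i - G i) <= d) ->
  absv (\prod_(i <- s) F i - \prod_(i <- s) G i) <= d * M ^+ size s.
Proof.
move=> M1 d0 dM; have M0 : 0 <= M by rewrite (le_trans ler01).
elim: s => [|i s IH] GM FG.
  by rewrite !big_nil subrr absv0 expr0 mulr1.
have is_ : i \in i :: s by rewrite mem_head.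
have js j : j \in s -> j \in i :: s by rewrite in_cons orbC => ->.
have FM : absv (F i) <= M.
  by rewrite -(subrK (G i) (F i)) absvD_le// ?GM// (le_trans _ dM)// FG.
rewrite !big_cons /= (_ : _ - _ =
  F i * (\prod_(j <- s) F j - \prod_(j <- s) G j) +
  (F i - G i) * \prod_(j <- s) G j); last by ring.
apply: absvD_le; rewrite absvM exprS mulrCA.
  apply: ler_pM => //; try exact: absv_ge0.
  by rewrite IH// => j /js; [exact: GM|exact: FG].
rewrite mulrA [M * d]mulrC -mulrA ler_pM ?absv_ge0 ?FG//.
rewrite (@le_trans _ _ (M ^+ size s))//; last by rewrite ler_peMl// exprn_ge0.
by rewrite absv_prod prod_seq_le// => j js_; rewrite absv_ge0/= GM// js.
Qed.

Lemma na_cvg_unique u l l' : u @ \oo --> l -> u @ \oo --> l' -> l = l'.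
Proof.
move=> /na_cvgP ul /na_cvgP ul'; apply/subr0_eq/absv_le0 => e e0.
have [N Nl] := ul _ e0; have [N' Nl'] := ul' _ e0.
rewrite ltW// (_ : l - l' = (l - u (maxn N N')) - (l' - u (maxn N N'))).
  by rewrite absv_lt_maxB// ?Nl ?Nl'// ?leq_maxl ?leq_maxr.
by rewrite opprB addrA subrK.
Qed.

Lemma na_cvg_lim u l : u @ \oo --> l -> lim (u @ \oo) = l.
Proof. by move=> ul; apply: (@na_cvg_unique u) => //; exact: cvgP ul. Qed.

Definition na_null u := forall e, 0 < e ->
  exists N, forall n, (N <= n)%N -> absv (u n) < e.

Definition sums u l := series u @ \oo --> l.

Lemma sumsP u l : sums u l <->
  forall e, 0 < e -> exists N, forall n, (N <= n)%N ->
    absv (l - \sum_(i < n) u i) < e.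
Proof.
rewrite /sums na_cvgP.
by split=> h e /h[N Nh]; exists N => n /Nh; rewrite /series /= big_mkord.
Qed.

Lemma sumsD u v l l' : sums u l -> sums v l' -> sums (fun n => u n + v n) (l + l').
Proof.
move=> ul vl'; have := na_cvgD ul vl'; rewrite /sums.
rewrite (_ : series (fun n => u n + v n) = fun n => series u n + series v n)//.
by apply/funext => n; rewrite /series /= big_split.
Qed.

Lemma sumsZ u l x : sums u l -> sums (fun n => x * u n) (x * l).
Proof.
move=> /sumsP ul; apply/sumsP => e e0.
have M0 : 0 < 1 + absv x by rewrite ltr_wpDr ?absv_ge0.
have [N Nu] := ul (e / (1 + absv x)) (divr_gt0 e0 M0).
exists N => n /Nu; rewrite ltr_pdivlMr// => h.
rewrite -mulr_sumr -mulrBr absvM (le_lt_trans _ h)// mulrC ler_wpM2l ?absv_ge0//.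
by rewrite lerDr.
Qed.

Lemma sumsN u l : sums u l -> sums (fun n => - u n) (- l).
Proof.
move=> /(@sumsZ _ _ (-1)); rewrite mulN1r; congr sums.
by apply/funext => n; rewrite mulN1r.
Qed.

Lemma sumsB u v l l' : sums u l -> sums v l' -> sums (fun n => u n - v n) (l - l').
Proof. by move=> ul /sumsN; exact: sumsD. Qed.

Lemma sums_sum (I : Type) (r : seq I) (U : I -> nat -> C) (L : I -> C) :
  (forall i, sums (U i) (L i)) ->
  sums (fun n => \sum_(i <- r) U i n) (\sum_(i <- r) L i).
Proof.
move=> UL; elim: r => [|i r IH].
  apply/sumsP => e e0; exists 0 => n _.
  by rewrite big_nil big1 ?subrr ?absv0// => i _; rewrite big_nil.
have := sumsD (UL i) IH; rewrite big_cons; congr sums.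
by apply/funext => n; rewrite big_cons.
Qed.

Lemma sums_finite u m : (forall n, (m <= n)%N -> u n = 0) ->
  sums u (\sum_(i < m) u i).
Proof.
move=> um; apply/sumsP => e e0; exists m => n mn.
rewrite -(subnKC mn) big_split_ord /= [X in _ - (_ + X)]big1 ?addr0 ?subrr ?absv0//.
by move=> i _; rewrite um// leq_addr.
Qed.

Lemma sums_poly (q : {poly C}) y : sums (fun k => q`_k * y ^+ k) q.[y].
Proof.
rewrite horner_coef; apply: sums_finite => k qk.
by rewrite nth_default// mul0r.
Qed.

Lemma sums_le u l e : 0 <= e -> (forall n, absv (u n) <= e) -> sums u l ->
  absv l <= e.
Proof.
move=> e0 ue /sumsP ul; apply/ler_addgt0Pr => d d0; have [N Nu] := ul _ d0.
rewrite -(subrK (\sum_(i < N) u i) l) absvD_le//.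
  by rewrite (le_trans (ltW (Nu _ (leqnn _))))// lerDr.
rewrite absv_sum_le ?addr_ge0 ?(ltW d0)// => i _.
by rewrite (le_trans (ue _))// lerDl ltW.
Qed.

Lemma sums_shift m u l : sums u l ->
  sums (fun n => u (m + n)%N) (l - \sum_(i < m) u i).
Proof.
move=> /sumsP ul; apply/sumsP => e /ul[N Nu]; exists N => n Nn.
have := Nu (m + n)%N (leq_trans Nn (leq_addl _ _)).
by rewrite big_split_ord /= opprD addrA.
Qed.

Lemma sums_tail u l e m : 0 <= e -> (forall n, (m <= n)%N -> absv (u n) <= e) ->
  sums u l -> absv (l - \sum_(i < m) u i) <= e.
Proof.
by move=> e0 ue /(@sums_shift m); apply: sums_le => // n; apply: ue; rewrite leq_addr.
Qed.

Lemma sums_null u l : sums u l -> na_null u.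
Proof. by move=> ul; apply: na_cvg_term; exact: cvgP ul. Qed.

Lemma sums_bounded u l : sums u l -> exists2 M, 0 < M & forall n, absv (u n) <= M.
Proof. by move=> ul; apply: na_bounded; exact: cvgP ul. Qed.

Lemma conv_sum u v n :
  \sum_(m < n) Defs.conv u v m = \sum_(i < n) u i * \sum_(j < n - i) v j.
Proof.
rewrite (big_triangle (fun i j => u i * v j)).
by apply: eq_bigr => i _; rewrite mulr_sumr.
Qed.

(** The value of the limit makes evaluation multiplicative. Grouped by the first index, the error is
    a remainder of [u] times [l'] plus terms [u i] times a remainder of [v]: for large i the factor
    [u i] is small, for small i the remainder starts late. *)
Lemma sums_conv u v l l' : sums u l -> sums v l' -> sums (Defs.conv u v) (l * l').
Proof.
move=> ul vl'; have [M1 M10 uM] := sums_bounded ul.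
have [M2 M20 vM] := sums_bounded vl'.
have l'M : absv l' <= M2 by apply: sums_le vl' => //; exact: ltW.
have tailM n : absv (l' - \sum_(j < n) v j) <= M2.
  by apply: sums_tail vl' => //; exact: ltW.
apply/sumsP => e e0.
have d0 : 0 < e / 2 / (M1 + M2) by rewrite !divr_gt0// addr_gt0.
have dM1 : e / 2 / (M1 + M2) * M1 <= e / 2.
  by rewrite mulrAC ler_pdivrMr ?addr_gt0// ler_wpM2l ?divr_ge0 ?ltW// ltrDl.
have dM2 : e / 2 / (M1 + M2) * M2 <= e / 2.
  by rewrite mulrAC ler_pdivrMr ?addr_gt0// ler_wpM2l ?divr_ge0 ?ltW// ltrDr.
have [N1 uN] := sums_null ul d0.
have [N2 lN] := (sumsP _ _).1 ul _ d0; have [N3 lN'] := (sumsP _ _).1 vl' _ d0.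
exists (N1 + N2 + N3)%N => n Nn; rewrite conv_sum.
have -> : l * l' - \sum_(i < n) u i * \sum_(j < n - i) v j =
  (l - \sum_(i < n) u i) * l' + \sum_(i < n) u i * (l' - \sum_(j < n - i) v j).
  rewrite mulrBl mulr_suml -addrA; congr (_ + _).
  under [X in _ = _ + X]eq_bigr => i _ do rewrite mulrBr.
  by rewrite sumrB addrA addNr add0r.
apply: (@le_lt_trans _ _ (e / 2)); last first.
  by rewrite ltr_pdivrMr// ltr_pMr// ltr1n.
apply: absvD_le.
  rewrite absvM (le_trans _ dM2)// ler_pM ?absv_ge0// ltW// lN//; lia.
apply: absv_sum_le => [|i _]; first by rewrite divr_ge0// ltW.
rewrite absvM; have [Ni|iN] := leqP N1 i.
  by rewrite (le_trans _ dM2)// ler_pM ?absv_ge0// ltW// uN.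
rewrite (le_trans _ dM1)// [leRHS]mulrC ler_pM ?absv_ge0// ltW// lN'//; lia.
Qed.

Lemma geometric_null (t M e : R) : 0 <= t < 1 -> 0 < e ->
  exists N, forall n, (N <= n)%N -> M * t ^+ n < e.
Proof.
move=> /andP[t0 t1] e0.
have M0 : 0 < 1 + `|M| by rewrite ltr_wpDr ?normr_ge0.
have : (fun n => t ^+ n) @ \oo --> (0 : R) by apply: cvg_expr; rewrite ger0_norm.
move=> /cvgrPdist_lt/(_ _ (divr_gt0 e0 M0))[N _ h]; exists N => n /h /=.
rewrite sub0r normrN ger0_norm ?exprn_ge0// ltr_pdivlMr// => h'.
rewrite (le_lt_trans _ h')// mulrC ler_wpM2l ?exprn_ge0//.
by rewrite (le_trans (ler_norm _))// lerDr.
Qed.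

Lemma geometric_na_null u (t M : R) : 0 <= t < 1 ->
  (forall n, absv (u n) <= M * t ^+ n) -> na_null u.
Proof.
move=> t1 ut e /(geometric_null M t1)[N h].
by exists N => n /h; exact: le_lt_trans.
Qed.

Hypothesis C_complete :
  forall G : set_system C, ProperFilter G -> cauchy G -> cvg G.

Lemma na_null_sums u : na_null u -> exists l, sums u l.
Proof.
move=> u0; suff h : cvg (series u @ \oo) by exists (lim (series u @ \oo)).
apply: C_complete; apply: cauchy_exP => e e0.
have [N Nu] := u0 _ e0; exists (series u N), N => // n /= Nn.
rewrite /ball /= /na_ball absv_distC /series /= (big_cat_nat (leq0n N) Nn)/=.
rewrite addrAC subrr add0r.
by apply: absv_sum_lt => // i; rewrite mem_index_iota => /andP[/Nu].
Qed.

End NAField.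

Arguments sumsZ {R C u l} x.
Arguments sums_poly {R C} q y.
Arguments sums_sum {R C I} r {U L}.

(** * Evaluation and seminorms of Laurent series *)

Section LaurentRing.
Variables (R : realType) (K : fieldType) (C : naFieldType R).
Variable iK : {rmorphism K -> C}.
Implicit Types (g h : laurent iK) (z : C) (A m : nat) (r e : R).

Lemma leval_sums A g z : polar_bound A g -> 0 < absv z < 1 ->
  sums (lterm iK A g z) (leval iK g z).
Proof.
move=> gA z1; have [_ /(_ z z1)] := laurentP g.
by rewrite /sums -(lpsum_cvg iK z _ gA).
Qed.

Lemma sums_leval A (g : int -> K) z l : polar_bound A g -> sums (lterm iK A g z) l ->
  leval iK g z = l.
Proof. by move=> gA; rewrite /sums -(lpsum_cvg iK z _ gA); exact: na_cvg_lim. Qed.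

Lemma levalB z : 0 < absv z < 1 ->
  {morph (fun g => leval iK g z) : g h / g - h}.
Proof.
move=> z1 g h /=; have [[A gA] [B hB]] := (laurent_polar g, laurent_polar h).
have {}gA : polar_bound (A + B) g by apply: polar_bound_le gA; rewrite leq_addr.
have {}hB : polar_bound (A + B) h by apply: polar_bound_le hB; rewrite leq_addl.
apply: (@sums_leval (A + B)) => [k kAB|].
  by rewrite -[LHS]/(g k - h k) gA// hB// subr0.
have := sumsB (leval_sums gA z1) (leval_sums hB z1); congr sums.
by apply/funext => k; rewrite -mulrBl -rmorphB.
Qed.

Lemma levalM z : 0 < absv z < 1 ->
  {morph (fun g => leval iK g z) : g h / g * h}.
Proof.
move=> z1 g h /=; have [[A gA] [B hB]] := (laurent_polar g, laurent_polar h).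
have z0 : z != 0 by case/andP : z1 => /absv_neq0.
apply: (@sums_leval (A + B)); first exact: lmul_polar.
have := sums_conv (leval_sums gA z1) (leval_sums hB z1); congr sums.
apply/funext => m; rewrite /lterm lshift_lmul// /Defs.conv rmorph_sum mulr_suml.
apply: eq_bigr => i _; rewrite rmorphM/= mulrACA; congr (_ * _).
by rewrite -expfzDr//; congr (z ^ _); have := ltn_ord i; lia.
Qed.

Definition lmono_coef (a : K) (n k : int) : K := if k == n then a else 0.

Lemma lmono_polar a n : polar_bound `|n| (lmono_coef a n).
Proof. by move=> k kn; rewrite /lmono_coef ifN//; lia. Qed.

Lemma lmono_lterm a n z i : lterm iK `|n| (lmono_coef a n) z i =
  if i == `|(n + `|n|%N%:Z)%R|%N then iK a * z ^ n else 0.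
Proof.
rewrite /lterm /Defs.lshift /lmono_coef /=.
rewrite (_ : (_ == n) = (i == `|(n + `|n|%N%:Z)%R|%N)); last by lia.
by case: eqP => [->|_]; rewrite ?rmorph0 ?mul0r//; congr (_ * z ^ _); lia.
Qed.

Lemma lmono_sums a n z :
  sums (lterm iK `|n| (lmono_coef a n) z) (iK a * z ^ n).
Proof.
pose m := `|(n + `|n|%N%:Z)%R|%N.
have -> : iK a * z ^ n = \sum_(i < m.+1) lterm iK `|n| (lmono_coef a n) z i.
  rewrite big_ord_recr big1 /= ?add0r => [|i _].
    by rewrite lmono_lterm eqxx.
  by rewrite lmono_lterm ifN// neq_ltn ltn_ord.
by apply: sums_finite => i mi; rewrite lmono_lterm ifN// neq_ltn mi orbT.
Qed.

Lemma lmono_lconvergent a n : lconvergent iK (lmono_coef a n).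
Proof.
split=> [|z z1]; first by apply/polar_boundP; exists `|n|%N; exact: lmono_polar.
apply/(lpsum_is_cvg _ _ (@lmono_polar a n)).
by apply: (cvgP (iK a * z ^ n)); exact: lmono_sums.
Qed.

(** Nonnegative exponents give the rows of the multiplication matrix; the exponent -1 supplies the
    inverse of [psi] when dividing by x. *)
Definition lmono a n : laurent iK := Laurent (asboolT (lmono_lconvergent a n)).

Lemma leval_lmono a n z : leval iK (lmono a n) z = iK a * z ^ n.
Proof. apply: (@sums_leval `|n|%N); [exact: lmono_polar|exact: lmono_sums]. Qed.

Lemma lone_lmono : 1 = lmono 1 0.
Proof. by apply/val_inj/funext => k; rewrite /= /lone /lmono_coef; case: eqP. Qed.

Lemma leval1 z : leval iK (1 : laurent iK) z = 1.
Proof. by rewrite lone_lmono leval_lmono rmorph1 expr0z mulr1. Qed.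

(** The proof [z1] is an argument so that a ring morphism structure can be attached; traces and
    determinants then commute with evaluation. *)
Definition leval_at z (z1 : 0 < absv z < 1) : laurent iK -> C :=
  fun g => leval iK g z.

HB.instance Definition _ z (z1 : 0 < absv z < 1) :=
  GRing.isZmodMorphism.Build _ _ (@leval_at z z1) (levalB z1).

HB.instance Definition _ z (z1 : 0 < absv z < 1) :=
  GRing.isMonoidMorphism.Build _ _ (@leval_at z z1) (leval1 z, levalM z1).

Lemma leval0 z : 0 < absv z < 1 -> leval iK (0 : laurent iK) z = 0.
Proof. by move=> z1; exact: (raddf0 (leval_at z1)). Qed.

Lemma levalD z : 0 < absv z < 1 ->
  {morph (fun g => leval iK g z) : g h / g + h}.
Proof. by move=> z1; exact: (raddfD (leval_at z1)). Qed.

(** Strong induction: once the coefficients below m vanish, the term of index m at a small z is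
    minus the remainder of the series, which is at most |z| ^ m e; hence |b m| <= e for every e. *)
Lemma power_series_eq0 (b : nat -> K) : (exists x : C, 0 < absv x < 1) ->
  (forall z, 0 < absv z < 1 -> sums (fun m => iK (b m) * z ^+ m) 0) ->
  forall m, b m = 0.
Proof.
move=> [x /andP[x0 x1]] b0; elim/ltn_ind => m IH.
have xn0 := absv_neq0 x0.
have [M M0 bM] : exists2 M, 0 < M & forall n, absv (iK (b n) * x ^+ n) <= M.
  by apply: (@sums_bounded _ _ _ 0); apply: b0; rewrite x0.
apply/eqP; rewrite -(fmorph_eq0 iK); apply/eqP/absv_le0 => e e0.
have x01 : 0 <= absv x < 1 by rewrite ltW.
have [N xN] := geometric_null (M / absv x ^+ m.+1) x01 e0.
(* For n = m + 1 + k, the factor z ^ (k + 1) of z ^ n splits into x ^ k, which together with [b n]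
   is bounded by M / |x| ^ (m + 1), then x ^ N, which brings this below e, and a power of x of
   absolute value at most 1. *)
pose z := x ^+ N.+2.
have z1 : 0 < absv z < 1 by rewrite absvX exprn_gt0// exprn_ilt1// ltW.
have z0 : 0 < absv z ^+ m by rewrite exprn_gt0//; case/andP : z1.
have : absv (0 - \sum_(i < m.+1) iK (b i) * z ^+ i) <= absv z ^+ m * e.
  apply: sums_tail (b0 z z1); first by rewrite mulr_ge0// ltW.
  move=> n mn; pose k := (n - m.+1)%N.
  have -> : iK (b n) * z ^+ n = z ^+ m * ((iK (b n) * x ^+ n) / x ^+ m.+1 *
      x ^+ N * x ^+ (2 + N.+1 * k)%N).
    have nE : n = (m.+1 + k)%N by rewrite /k; lia.
    have -> : iK (b n) * x ^+ n / x ^+ m.+1 = iK (b n) * x ^+ k.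
      by rewrite [in x ^+ n]nE exprD [x ^+ m.+1 * _]mulrC mulrA mulfK ?expf_neq0.
    rewrite -!mulrA mulrCA; congr (_ * _); rewrite /z.
    by rewrite -!exprM -!exprD; congr (x ^+ _); nia.
  rewrite absvM absvX; apply: ler_wpM2l; first exact: ltW.
  rewrite absvM -[leRHS]mulr1; apply: ler_pM; rewrite ?absv_ge0//.
    rewrite (le_trans _ (ltW (xN _ (leqnn _))))// absvM (absvX x N).
    apply: ler_wpM2r; first by rewrite exprn_ge0// ltW.
    rewrite absvM; apply: ler_pM; rewrite ?absv_ge0//.
    by rewrite absvV absvX.
  by rewrite absvX; apply: exprn_ile1; exact: ltW.
rewrite sub0r absvN big_ord_recr big1 /= ?add0r => [|i _]; last first.
  by rewrite /= IH// rmorph0 mul0r.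
by rewrite (absvM (iK _)) (absvX z) [X in X <= _]mulrC ler_pM2l.
Qed.

Lemma laurent_ext g h : (exists x : C, 0 < absv x < 1) ->
  (forall z, 0 < absv z < 1 -> leval iK g z = leval iK h z) -> g = h.
Proof.
move=> ex gh; apply/subr0_eq; set d := g - h.
have [A dA] := laurent_polar d.
have d0 : forall m, Defs.lshift A d m = 0.
  apply: power_series_eq0 => // z z1.
  have := leval_sums dA z1; rewrite levalB// gh// subrr => /(sumsZ (z ^+ A)).
  rewrite mulr0; congr sums; apply/funext => m.
  have z0 : z != 0 by case/andP : z1 => /absv_neq0.
  rewrite /lterm mulrCA; congr (_ * _).
  by rewrite !exprnP -expfzDr//; congr (z ^ _); lia.
by apply/val_inj/(Defs.lshift_inj dA) => [k _|m]; rewrite ?d0.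
Qed.

(** The absolute values of the terms depend only on |z|, so convergence at one point bounds the
    whole sphere. The supremum in [lseminorm] is meaningful only thanks to this bound. *)
Lemma leval_bounded g z : 0 < absv z < 1 ->
  exists M, forall w, absv w = absv z -> absv (leval iK g w) <= M.
Proof.
move=> z1; have [A gA] := laurent_polar g.
have [M M0 gM] := sums_bounded (leval_sums gA z1).
exists M => w wz; apply: sums_le (leval_sums gA _); rewrite ?wz// ?ltW// => m.
by have := gM m; rewrite /lterm !absvM !absvXz wz.
Qed.

Lemma le_lseminorm g r z : 0 < r < 1 -> absv z = r ->
  absv (leval iK g z) <= lseminorm r g.
Proof.
move=> r1 zr; apply: sup_upper_bound; last by exists z.
split; first by exists (absv (leval iK g z)), z.
rewrite -zr in r1; have [M gM] := leval_bounded g r1.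
by exists M => _ [w wr <-]; apply: gM; rewrite wr.
Qed.

Lemma lseminorm_le g r e : (exists z : C, absv z = r) ->
  (forall z, absv z = r -> absv (leval iK g z) <= e) -> lseminorm r g <= e.
Proof.
move=> [z zr] ge; apply: sup_le_ub; first by exists (absv (leval iK g z)), z.
by move=> _ [w wr <-]; exact: ge.
Qed.

Lemma lseminormD g h r : 0 < r < 1 -> (exists z : C, absv z = r) ->
  lseminorm r (g + h) <= Num.max (lseminorm r g) (lseminorm r h).
Proof.
move=> r1 rz; apply: lseminorm_le => // z zr; rewrite levalD ?zr//.
by rewrite (le_trans (absvD_max _ _))// le_max2// le_lseminorm.
Qed.

Lemma lseminorm_nbhs g r e : 0 < r < 1 -> (exists z : C, absv z = r) -> 0 < e ->
  nbhs g [set a | lseminorm r (a - g) < e].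
Proof.
move=> r1 rz e0.
have gU : lseminorm r (g - g) < e.
  rewrite subrr (le_lt_trans _ e0)// lseminorm_le// => z zr.
  by rewrite leval0 ?absv0// zr.
have : open_nbhs g [set a | lseminorm r (a - g) < e].
  split => //; exists [set [set a | lseminorm r (a - g) < e]]; last first.
    by rewrite bigcup_set1.
  move=> _ ->;
  apply: (@finI_from1 (set (laurent iK) : pointedType) _ (@lseminorm_ball R K C iK) id).
  by exists r; split => //; exists g, e.
by rewrite open_nbhsE => -[].
Qed.

(** By the ultrametric inequality a subbasic ball containing [T g] contains the ball of the same
    radius centred at [T g], so balls with arbitrary centres [b] need not be considered. *)
Lemma laurent_continuous (T : laurent iK -> laurent iK) :
  (forall g s e, 0 < s < 1 -> (exists z : C, absv z = s) -> 0 < e ->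
    nbhs g [set a | lseminorm s (T a - T g) < e]) ->
  continuous T.
Proof.
move=> hT g U; rewrite /= nbhsE => -[_ [[B BD <-] [V BV Vg]] VU].
have [D Dsub DE] := BD _ BV.
suff : nbhs g (\bigcap_(W in [set` D]) [set a | W (T a)]).
  by apply: filterS => a Va; apply: VU; exists V => //; rewrite -DE.
apply: (@filter_bigI _ _ D (fun W => [set a | W (T a)])) => W WD.
have /set_mem := Dsub _ WD => -[s [s1 [z zs] [b [e WE]]]].
have : W (T g) by move: Vg; rewrite -DE; apply.
rewrite WE /= => Tge.
have z1 : 0 < absv z < 1 by rewrite zs.
have e0 : 0 < e.
  by rewrite (le_lt_trans _ Tge)// (le_trans (absv_ge0 _) (le_lseminorm _ s1 zs)).
have := hT g s e s1 (ex_intro _ z zs) e0; apply: filterS => a /= ae.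
rewrite -(subrK (T g) (T a)) -addrA (le_lt_trans (lseminormD _ _ s1 _)) ?gt_max ?ae//.
by exists z.
Qed.

End LaurentRing.

(** * Division by [psi (x) - y] *)

(** Up to sign the coefficient is the elementary symmetric function of degree [size V - j] in the
    elements of [V]. *)
Lemma coef_prod_XsubC_le (R : realType) (C : naFieldType R) (V : seq C) (r : R) :
  0 <= r -> (forall u, u \in V -> absv u <= r) ->
  forall j, (j <= size V)%N ->
    absv (\prod_(u <- V) ('X - u%:P))`_j <= r ^+ (size V - j).
Proof.
move=> r0; elim: V => [|u V IH] Vr j.
  by rewrite leqn0 => /eqP ->; rewrite big_nil coef1 absv1 expr0.
have ur : absv u <= r by rewrite Vr// mem_head.
have {}IH := IH (fun v vV => Vr v (mem_behead (s := u :: V) vV)).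
rewrite big_cons mulrBl coefB coefXM coefCM; case: j => [|j] /= jV.
  by rewrite sub0r absvN absvM subn0 exprS ler_pM ?absv_ge0//= -[size V]subn0 IH.
rewrite subSS absvD_le// ?IH// absvN absvM.
have [jV'|Vj] := ltnP j (size V); last first.
  have -> : (\prod_(v <- V) ('X - v%:P))`_j.+1 = 0.
    by rewrite nth_default// size_prod_XsubC.
  by rewrite absv0 mulr0 exprn_ge0.
by rewrite (_ : size V - j = (size V - j.+1).+1)%N ?exprS ?ler_pM ?absv_ge0 ?IH//; lia.
Qed.

Section Division.
Variables (R : realType) (K : fieldType) (C : naFieldType R).
Variable iK : {rmorphism K -> C}.
Hypothesis C_complete :
  forall G : set_system C, ProperFilter G -> cauchy G -> cvg G.
(** [K] carries no topology here; its completeness is expressed by the closedness of its image in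
    [C]. *)
Hypothesis K_closed : forall (u : nat -> K) (l : C),
  (iK \o u) @ \oo --> l -> exists k, iK k = l.
Hypothesis absv_dense : forall (t : R) n, t < 1 -> (0 < n)%N ->
  exists x : C, 0 < absv x < 1 /\ t < absv x ^+ n.
Variables (p : {poly K}) (V : seq C).
Hypothesis pV : map_poly iK p = \prod_(u <- V) ('X - u%:P).
Hypothesis V_lt1 : forall u, u \in V -> absv u < 1.
Hypothesis V0 : 0 \in V.

Local Notation Q := (size V).
Local Notation psi := (map_poly iK p).

Let Q_gt0 : (0 < Q)%N.
Proof. by case: V V0. Qed.

Let psi_size : size psi = Q.+1.
Proof. by rewrite pV size_prod_XsubC. Qed.

Let psi_lead : psi`_Q = 1.
Proof.
have : psi \is monic by rewrite pV monic_prod_XsubC.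
by rewrite monicE /lead_coef psi_size => /eqP.
Qed.

Let psi_coef0 : p`_0 = 0.
Proof.
apply/eqP; rewrite -(fmorph_eq0 iK) -coef_map -horner_coef0 pV -rootE.
by rewrite root_prod_XsubC.
Qed.

Lemma psi_horner z : psi.[z] = \prod_(u <- V) (z - u).
Proof. by rewrite pV horner_prod_XsubC. Qed.

Lemma V_radius : exists2 r : R, 0 < r < 1 & forall u, u \in V -> absv u <= r.
Proof.
have [x [/andP[x0 x1] _]] := absv_dense ltr01 (ltnSn 0).
elim: V V_lt1 => [|u s IH] s1; first by exists (absv x); rewrite ?x0.
have [|r /andP[r0 r1] rs] := IH; first by move=> v vs; rewrite s1// in_cons vs orbT.
exists (Num.max (absv u) r); first by rewrite lt_max r0 orbT gt_max s1 ?mem_head.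
move=> v; rewrite in_cons => /orP[/eqP ->|/rs vr]; rewrite le_max ?lexx//.
by rewrite vr orbT.
Qed.

(* [xrem n j] is, as a polynomial in [psi], the coefficient of [x ^+ n] on
   [x ^+ j] in the basis [1, x, ..., x ^+ Q.-1]. *)
Fixpoint xrem (n j : nat) : {poly K} :=
  if n is n'.+1 then
    (if j is j'.+1 then xrem n' j' else 'X * xrem n' Q.-1) - p`_j *: xrem n' Q.-1
  else (j == 0)%:R.

Lemma psi_expand z : psi.[z] = z ^+ Q + \sum_(j < Q) iK p`_j * z ^+ j.
Proof.
rewrite horner_coef psi_size big_ord_recr /= psi_lead mul1r addrC.
by congr (_ + _); apply: eq_bigr => j _; rewrite coef_map.
Qed.

(** Multiplication by z shifts the basis, and the overflow z ^ Q equals psi z minus the lower terms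
    of [psi]: this is the recursion of [xrem]. *)
Lemma xrem_expand n z :
  z ^+ n = \sum_(j < Q) z ^+ j * (map_poly iK (xrem n j)).[psi.[z]].
Proof.
elim: n => [|n IH].
  rewrite -(prednK Q_gt0) big_ord_recl big1 ?addr0 => [|i _].
    by rewrite /= rmorph1 hornerC mulr1.
  by rewrite /= rmorph0 horner0 mulr0.
move: (psi_expand z) IH; move: psi.[z] => y yE IH.
set c := fun j => (map_poly iK (xrem n j)).[y].
have -> : \sum_(j < Q) z ^+ j * (map_poly iK (xrem n.+1 j)).[y] =
    (\sum_(j < Q) z ^+ j * (if (j : nat) is j'.+1 then c j' else y * c Q.-1)) -
    (\sum_(j < Q) iK p`_j * z ^+ j) * c Q.-1.
  rewrite mulr_suml -sumrB; apply: eq_bigr => j _.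
  rewrite /= rmorphB /= map_polyZ hornerD hornerN hornerZ mulrBr -/(c _).
  congr (_ - _); last by rewrite mulrCA mulrA.
  by case: (j : nat) => //; rewrite rmorphM /= map_polyX hornerM hornerX.
rewrite exprS IH mulr_sumr.
have Qs : Q = Q.-1.+1 by rewrite prednK.
rewrite [in LHS]Qs [X in _ = X - _](_ : _ =
    y * c Q.-1 + \sum_(j < Q.-1) z ^+ j.+1 * c j).
  rewrite big_ord_recr /= -/(c _) mulrA -exprS -Qs {2}yE mulrDl.
  rewrite addrAC addrK addrC; congr (_ + _).
  by apply: eq_bigr => j _; rewrite mulrA -exprS.
have sumQ (G : nat -> C) : \sum_(j < Q) G j = G 0 + \sum_(j < Q.-1) G j.+1.
  by rewrite [in LHS]Qs big_ord_recl.
by rewrite (sumQ (fun j => z ^+ j * if j is j'.+1 then c j' else y * c Q.-1)) mul1r.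
Qed.

(** A Gauss norm estimate with weight r for x and r ^ Q for y = psi x. Since |p_j| <= r ^ (Q - j),
    replacing x ^ Q by y minus the lower terms does not increase this norm. *)
Lemma xrem_le (r : R) : 0 <= r -> (forall u, u \in V -> absv u <= r) ->
  forall n j k, (j < Q)%N ->
    absv (iK (xrem n j)`_k) * r ^+ (Q * k) * r ^+ j <= r ^+ n.
Proof.
move=> r0 Vr; have pr j : (j < Q)%N -> absv (iK p`_j) <= r ^+ (Q - j).
  move=> jQ; rewrite -coef_map pV coef_prod_XsubC_le// ltnW//.
have rX m : 0 <= r ^+ m by rewrite exprn_ge0.
elim=> [|n IH] j k jQ.
  case: j jQ => [|j] _ /=; last by rewrite coef0 rmorph0 absv0 !mul0r.
  rewrite coef1; case: k => [|k]; first by rewrite rmorph1 absv1 muln0 !expr0 !mulr1.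
  by rewrite rmorph0 absv0 !mul0r.
have IHl k' : absv (iK (xrem n Q.-1)`_k') * r ^+ (Q * k') * r ^+ Q.-1 <= r ^+ n.
  by apply: IH; rewrite prednK.
rewrite -mulrA /= coefB rmorphB; set s := r ^+ (Q * k) * r ^+ j.
have s0 : 0 <= s by rewrite mulr_ge0.
have [le1 le2] :
    absv (iK ((if j is j'.+1 then xrem n j' else 'X * xrem n Q.-1) : {poly K})`_k) * s
      <= r ^+ n.+1 /\
    absv (iK (p`_j *: xrem n Q.-1)`_k) * s <= r ^+ n.+1.
  split; last first.
    rewrite coefZ rmorphM absvM.
    apply: (@le_trans _ _ (r ^+ (Q - j) * absv (iK (xrem n Q.-1)`_k) * s)).
      by rewrite ler_wpM2r// ler_wpM2r ?absv_ge0// pr.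
    have -> : r ^+ (Q - j) * absv (iK (xrem n Q.-1)`_k) * s =
        r * (absv (iK (xrem n Q.-1)`_k) * r ^+ (Q * k) * r ^+ Q.-1).
      have : r ^+ (Q - j) * r ^+ j = r * r ^+ Q.-1.
        by rewrite -exprD -exprS; congr (r ^+ _); lia.
      rewrite /s; move: (r ^+ (Q - j)) (r ^+ j) (r ^+ Q.-1) => x y z xy.
      by ring: xy.
    by rewrite exprS ler_wpM2l.
  case: j @s s0 jQ => [|j] s s0 jQ.
    rewrite coefXM; case: k @s s0 => [|k] s s0.
      by rewrite rmorph0 absv0 mul0r.
    have -> : absv (iK (xrem n Q.-1)`_k) * s =
        r * (absv (iK (xrem n Q.-1)`_k) * r ^+ (Q * k) * r ^+ Q.-1).
      rewrite /s expr0 mulr1 mulnS exprD -[in r ^+ Q](prednK Q_gt0) exprS.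
      by move: (r ^+ Q.-1) (r ^+ (Q * k)) => x y; ring.
    by rewrite exprS ler_wpM2l.
  have -> : absv (iK (xrem n j)`_k) * s =
      r * (absv (iK (xrem n j)`_k) * r ^+ (Q * k) * r ^+ j).
    by rewrite /s exprS; ring.
  by rewrite exprS ler_wpM2l// IH// ltnW.
apply: le_trans (ler_wpM2r s0 (absvD_max _ _)) _.
by rewrite absvN maxr_pMl// ge_max; apply/andP; split.
Qed.

Lemma K_sums_closed (u : nat -> K) l : sums (iK \o u) l -> exists k, iK k = l.
Proof.
move=> ul; apply: (K_closed (u := fun n => \sum_(i < n) u i)).
rewrite (_ : _ \o _ = series (iK \o u))//; apply/funext => n.
by rewrite /series /= big_mkord rmorph_sum.
Qed.

Section PowerSeries.
Variable a : nat -> K.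
Hypothesis a_cvg : forall z : C, 0 < absv z < 1 ->
  exists l, sums (fun n => iK (a n) * z ^+ n) l.

Lemma coef_null (z : C) : 0 < absv z < 1 -> (forall u, u \in V -> absv u <= absv z) ->
  forall j k, (j < Q)%N -> na_null (fun n => iK (a n * (xrem n j)`_k)).
Proof.
move=> z1 Vz j k jQ e e0; have [l al] := a_cvg z1.
have [z0 _] := andP z1.
have d0 : 0 < absv z ^+ (Q * k) * absv z ^+ j by rewrite mulr_gt0 ?exprn_gt0.
have [N aN] := sums_null al (mulr_gt0 e0 d0).
exists N => n /aN; rewrite rmorphM !absvM absvX => h.
rewrite -(ltr_pM2r d0) (le_lt_trans _ h)// -mulrA ler_wpM2l ?absv_ge0//.
by rewrite mulrA xrem_le// ltW.
Qed.

Lemma coef_limit : exists c : nat -> nat -> K, forall j k, (j < Q)%N ->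
  sums (fun n => iK (a n * (xrem n j)`_k)) (iK (c j k)).
Proof.
have [r /andP[r0 r1] Vr] := V_radius.
have [z [z1]] := absv_dense r1 (ltnSn 0); rewrite expr1 => rz.
have Vz u : u \in V -> absv u <= absv z by move=> /Vr/le_trans; apply; exact: ltW.
suff /choice[c cP] : forall jk : nat * nat, exists c, (jk.1 < Q)%N ->
    sums (fun n => iK (a n * (xrem n jk.1)`_jk.2)) (iK c).
  by exists (fun j k => c (j, k)) => j k; exact: (cP (j, k)).
move=> [j k] /=; case: (ltnP j Q) => [jQ|_]; last by exists 0.
have [l al] := na_null_sums C_complete (coef_null z1 Vz k jQ).
by have [c cl] := K_sums_closed al; exists c => _; rewrite cl.
Qed.

Definition nat_coef (c : nat -> K) (k : int) : K := if k is Posz m then c m else 0.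

Lemma nat_coef_polar c : polar_bound 0 (nat_coef c).
Proof. by case. Qed.

Lemma nat_coef_lterm c z m : lterm iK 0 (nat_coef c) z m = iK (c m) * z ^+ m.
Proof. by rewrite /lterm /Defs.lshift subr0. Qed.

(** Each x ^ n is expanded by [xrem], and the coefficients of equal powers of y are summed over n;
    [xrem_le] transfers the convergence from [a] to the resulting series. *)
Lemma power_decomposition : exists c : nat -> laurent iK,
  forall z l, absv z < 1 -> psi.[z] != 0 ->
    sums (fun n => iK (a n) * z ^+ n) l ->
    l = \sum_(j < Q) z ^+ j * leval iK (c j) psi.[z].
Proof.
have [c cP] := coef_limit.
(* The bound is uniform in k. With N = 0 it controls the growth of [c j]; with N large it controls
   the remainder in the final identity. *)
have c_le j k (r M : R) :
  (j < Q)%N -> 0 < r -> (forall u, u \in V -> absv u <= r) ->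
  0 <= M -> forall N, (forall n, (N <= n)%N -> absv (iK (a n)) * r ^+ n <= M) ->
  absv (iK (c j k) - \sum_(n < N) iK (a n * (xrem n j)`_k)) * r ^+ (Q * k) * r ^+ j <= M.
  move=> jQ r0 Vr M0 N aM; rewrite -mulrA -ler_pdivlMr ?mulr_gt0 ?exprn_gt0//.
  apply: sums_tail (cP j k jQ); first by rewrite divr_ge0// mulr_ge0// exprn_ge0// ltW.
  move=> n Nn; rewrite ler_pdivlMr ?mulr_gt0 ?exprn_gt0// (le_trans _ (aM n Nn))//.
  by rewrite rmorphM absvM -mulrA ler_wpM2l ?absv_ge0// mulrA xrem_le// ltW.
have lc j : (j < Q)%N -> lconvergent iK (nat_coef (c j)).
  move=> jQ; split=> [|w w1].
    by apply/polar_boundP; exists 0%N; exact: nat_coef_polar.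
  apply/(lpsum_is_cvg _ _ (@nat_coef_polar (c j))).
  have [r /andP[r0 r1] Vr] := V_radius.
  have [w0 wlt1] := andP w1.
  (* The point z has |w| < |z| ^ Q, so the series of [c j] at w is dominated by a geometric one of
     ratio |w| / |z| ^ Q. *)
  have : Num.max (absv w) (r ^+ Q) < 1 by rewrite gt_max wlt1 exprn_ilt1 ?ltW// -lt0n.
  move=> /(absv_dense)/(_ Q_gt0)[z [z1]]; rewrite gt_max => /andP[wz rz].
  have [z0 zlt1] := andP z1.
  have {}Vr u : u \in V -> absv u <= absv z.
    move=> /Vr/le_trans; apply.
    by rewrite -(ler_pXn2r Q_gt0) ?nnegrE ?absv_ge0 ?ltW.
  have [l al] := a_cvg z1; have [M M0 aM] := sums_bounded al.
  have cM k : absv (iK (c j k) * w ^+ k) <= M / absv z ^+ j * (absv w / absv z ^+ Q) ^+ k.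
    have := c_le j k (absv z) M jQ z0 Vr (ltW M0) 0%N.
    rewrite big_ord0 subr0 => H.
    rewrite absvM absvX.
    rewrite [leRHS](_ : _ = M / (absv z ^+ (Q * k) * absv z ^+ j) * absv w ^+ k).
      rewrite ler_wpM2r ?exprn_ge0 ?absv_ge0// ler_pdivlMr ?mulr_gt0 ?exprn_gt0// mulrA.
      by apply: H => n _; have := aM n; rewrite absvM absvX.
    by rewrite expr_div_n -exprM invfM; ring.
  have [s sl] : exists s, sums (lterm iK 0 (nat_coef (c j)) w) s.
    apply: (na_null_sums C_complete).
    apply: (geometric_na_null (t := absv w / absv z ^+ Q)).
      by rewrite divr_ge0 ?exprn_ge0 ?ltW// ltr_pdivrMr ?mul1r// exprn_gt0.
    by move=> k; rewrite nat_coef_lterm; exact: cM.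
  by apply: cvgP sl.
(* Convergence is known only for j < Q; the value 0 beyond is never evaluated in the sum. *)
exists (fun j => if pselect (j < Q)%N is left jQ then Laurent (asboolT (lc j jQ)) else 0).
move=> z l z1 y0 al; set y := psi.[z] in y0 *.
apply/subr0_eq/absv_le0 => e e0.
have [r /andP[r0 r1] Vr] := V_radius.
have : Num.max (absv z) r < 1 by rewrite gt_max z1.
move=> /absv_dense/(_ (ltn0Sn 0))[x [x1]]; rewrite expr1 gt_max => /andP[zx rx].
have [x0 xlt1] := andP x1.
have {}Vr u : u \in V -> absv u <= absv x.
  by move=> /Vr/le_trans; apply; exact: ltW.
have yx : absv y <= absv x ^+ Q.
  rewrite /y psi_horner absv_prod prod_seq_le// => u uV; rewrite absv_ge0/=.
  by apply: absvD_le; [exact: ltW|rewrite absvN Vr].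
have [s sx] := a_cvg x1; have [N1 aN] := sums_null sx e0.
have [N2 lN] := (sumsP _ _).1 al _ e0; pose N := maxn N1 N2.
(* Instead of exchanging two infinite sums, the first N terms are expanded exactly and both
   remainders are shown to be at most e. The remainder on x ^ j is at most e / |x| ^ j because |psi
   z| <= |x| ^ Q, and |z| <= |x| absorbs the denominator. *)
rewrite -(subrK (\sum_(n < N) iK (a n) * z ^+ n) l) -addrA absvD_le//.
  by rewrite ltW// lN// leq_maxr.
under eq_bigr do rewrite (xrem_expand _ z) mulr_sumr.
rewrite exchange_big -sumrB /=; apply: absv_sum_le => [|j _]; first exact: ltW.
case: pselect => // jQ; rewrite -/y.
under eq_bigr do rewrite mulrCA; rewrite -mulr_sumr -mulrBr absvM.
have [y_0 y_1] : 0 < absv y /\ absv y < 1.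
  by rewrite absv_gt0 y0 (le_lt_trans yx)// exprn_ilt1 ?ltW// -lt0n.
have cs : sums (fun k => iK (c j k) * y ^+ k)
    (leval iK (Laurent (asboolT (lc j jQ))) y).
  have := leval_sums (g := Laurent (asboolT (lc j jQ))) (z := y) (@nat_coef_polar (c j)).
  rewrite y_0 y_1 => /(_ isT); congr sums; apply/funext => k.
  exact: nat_coef_lterm.
have ps n : sums (fun k => iK (a n * (xrem n j)`_k) * y ^+ k)
    (iK (a n) * (map_poly iK (xrem n j)).[y]).
  have := sumsZ (iK (a n)) (sums_poly (map_poly iK (xrem n j)) y).
  by congr sums; apply/funext => k; rewrite coef_map rmorphM/= mulrA.
have := sumsB cs (sums_sum (index_enum 'I_N) (fun i : 'I_N => ps i)).
move=> /(@sums_le _ _ _ _ (e / absv x ^+ j)) H.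
apply: (@le_trans _ _ (absv x ^+ j * (e / absv x ^+ j))); last first.
  by rewrite mulrCA divff ?mulr1// gt_eqF// exprn_gt0.
rewrite absvX absv_distC ler_pM ?exprn_ge0 ?absv_ge0 ?lerXn2r ?nnegrE ?absv_ge0 ?(ltW zx)//.
apply: H => [|k]; first by rewrite divr_ge0 ?exprn_ge0 ?ltW.
rewrite -mulr_suml -mulrBl absvM absvX.
have := c_le j k (absv x) e jQ x0 Vr (ltW e0) N.
rewrite ler_pdivlMr ?exprn_gt0// => cN.
apply: le_trans (cN _) => [|n Nn]; last first.
  have := aN n (leq_trans (leq_maxl _ _) Nn).
  by rewrite absvM absvX => /ltW.
rewrite ler_wpM2r ?exprn_ge0 ?(ltW x0)// ler_wpM2l ?absv_ge0// exprM.
by rewrite lerXn2r ?nnegrE ?exprn_ge0 ?absv_ge0.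
Qed.

End PowerSeries.

Lemma psi_neq0 z : psi.[z] != 0 -> z != 0.
Proof.
by apply: contraNneq => ->; rewrite psi_horner (big_rem 0 V0)/= subr0 mul0r eqxx.
Qed.

Lemma psi_lt1 z : absv z < 1 -> absv psi.[z] < 1.
Proof.
move=> z1; have [r /andP[r0 r1] Vr] := V_radius.
have : Num.max (absv z) r < 1 by rewrite gt_max z1.
move=> /absv_dense/(_ (ltn0Sn 0))[x [/andP[x0 x1]]]; rewrite expr1 gt_max => /andP[zx rx].
apply: (@le_lt_trans _ _ (absv x ^+ Q)); last by rewrite exprn_ilt1 ?ltW// -lt0n.
rewrite psi_horner absv_prod prod_seq_le// => u uV; rewrite absv_ge0/=.
by apply: absvD_le; [exact: ltW|rewrite absvN (le_trans (Vr _ uV)) ?ltW].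
Qed.

Definition decomposable (F : C -> C) := exists c : nat -> laurent iK,
  forall z, absv z < 1 -> psi.[z] != 0 ->
    F z = \sum_(j < Q) z ^+ j * leval iK (c j) psi.[z].

(** The basis shifts down, with nothing arriving at the top index. The leftover c_0 / z is expanded
    again: as p_0 = 0, psi (z) / z is a polynomial of degree Q - 1, and 1 / z is this polynomial
    divided by psi (z). *)
Lemma decomposable_div F : decomposable F -> decomposable (fun z => F z / z).
Proof.
move=> [c cF]; exists (fun j => (if (j.+1 < Q)%N then c j.+1 else 0) +
  lmono iK p`_j.+1 (-1) * c 0%N) => z z1 y0.
have z0 := psi_neq0 y0.
have y1 : 0 < absv psi.[z] < 1 by rewrite absv_gt0 y0 psi_lt1.
have Qs : Q = Q.-1.+1 by rewrite prednK.
have sumQ (G : nat -> C) : \sum_(j < Q) G j = G 0 + \sum_(j < Q.-1) G j.+1.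
  by rewrite [in LHS]Qs big_ord_recl.
have sumQr (G : nat -> C) : \sum_(j < Q) G j = \sum_(j < Q.-1) G j + G Q.-1.
  by rewrite [in LHS]Qs big_ord_recr.
under eq_bigr do rewrite levalD// levalM// leval_lmono mulrDr.
rewrite big_split /= [X in _ = X + _](sumQr (fun j =>
  z ^+ j * leval iK (if (j.+1 < Q)%N then c j.+1 else 0) psi.[z])).
rewrite prednK// ltnn leval0// mulr0 addr0.
rewrite [X in _ = _ + X](_ : _ = leval iK (c 0%N) psi.[z] / z).
  rewrite cF// (sumQ (fun j => z ^+ j * leval iK (c j) psi.[z])) expr0 mul1r.
  rewrite mulrDl addrC; congr (_ + _); rewrite mulr_suml.
  apply: eq_bigr => j _; rewrite (_ : (j.+1 < Q)%N); last by have := ltn_ord j; lia.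
  by rewrite exprSr -!mulrA [leval _ _ _ / _]mulrC mulVKf.
have yE : psi.[z] = z * \sum_(j < Q) iK p`_j.+1 * z ^+ j.
  rewrite horner_coef psi_size big_ord_recl /= coef_map psi_coef0 raddf0 mul0r add0r.
  rewrite mulr_sumr; apply: eq_bigr => j _; rewrite coef_map.
  by rewrite exprS mulrCA.
transitivity ((\sum_(j < Q) iK p`_j.+1 * z ^+ j) / psi.[z] * leval iK (c 0%N) psi.[z]).
  rewrite !mulr_suml; apply: eq_bigr => j _.
  by rewrite -exprN1; ring.
rewrite {1}yE invfM mulrCA mulfV ?mulr1 1?mulrC//.
by apply: contraNneq y0; rewrite yE => ->; rewrite mulr0.
Qed.

(** A factor z ^ A clears the pole, and A divisions by z restore it. *)
Lemma laurent_decomposable (g : laurent iK) : decomposable (leval iK g).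
Proof.
have [A gA] := laurent_polar g.
have gs z : 0 < absv z < 1 ->
    sums (fun n => iK (Defs.lshift A g n) * z ^+ n) (z ^+ A * leval iK g z).
  move=> z1; have z0 : z != 0 by case/andP : z1 => /absv_neq0.
  have := sumsZ (z ^+ A) (leval_sums gA z1); congr sums.
  apply/funext => n; rewrite /lterm mulrCA; congr (_ * _).
  by rewrite !exprnP -expfzDr//; congr (z ^ _); lia.
have [c cP] := power_decomposition (fun z z1 => ex_intro _ _ (gs z z1)).
have d0 : decomposable (fun z => z ^+ A * leval iK g z).
  exists c => z z1 y0; apply: cP => //; apply: gs.
  by rewrite absv_gt0 (psi_neq0 y0).
have dn n : decomposable (fun z => z ^+ A * leval iK g z / z ^+ n).
  elim: n => [|n [d dP]].
    by have [d dP] := d0; exists d => z z1 y0; rewrite expr0 divr1; exact: dP.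
  have [d' dP'] := decomposable_div (ex_intro _ d dP); exists d' => z z1 y0.
  by rewrite -(dP' z z1 y0) /= exprS invfM; ring.
have [d dP] := dn A; exists d => z z1 y0; rewrite -dP// mulrAC mulfV ?mul1r//.
by rewrite expf_neq0// psi_neq0.
Qed.

(** * Trace and determinant of the multiplication matrix *)

Hypothesis V_uniq : uniq V.
Hypothesis psiD : forall x y, psi.[x + y] = psi.[x] + psi.[y].

Lemma psi_root u : u \in V -> psi.[u] = 0.
Proof. by move=> uV; rewrite psi_horner (big_rem u uV)/= subrr mul0r. Qed.

Lemma trace_norm_exist (g : laurent iK) : exists t n : laurent iK,
  forall z, absv z < 1 -> psi.[z] != 0 ->
    \sum_(u <- V) leval iK g (z + u) = leval iK t psi.[z] /\
    \prod_(u <- V) leval iK g (z + u) = leval iK n psi.[z].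
Proof.
have /choice[m mP] i : decomposable (leval iK (lmono iK 1 i%:Z * g)).
  exact: laurent_decomposable.
pose M : 'M[laurent iK]_Q := \matrix_(i, j) m i j.
exists (\tr M), (\det M) => z z1 y0.
have y1 : 0 < absv psi.[z] < 1 by rewrite absv_gt0 y0 psi_lt1.
pose lam : 'rV[C]_Q := \row_i (z + V`_i).
have lamP i : [/\ absv (lam 0 i) < 1, psi.[lam 0 i] = psi.[z] & 0 < absv (lam 0 i)].
  have iV : V`_i \in V by rewrite mem_nth.
  have e : psi.[lam 0 i] = psi.[z] by rewrite mxE psiD (psi_root iV) addr0.
  split=> //; first by rewrite mxE absv_lt_max// V_lt1.
  by rewrite absv_gt0 psi_neq0 ?e.
pose G : 'rV[C]_Q := \row_i leval iK g (lam 0 i).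
pose W := Vandermonde Q lam.
have W_unit : W \in unitmx.
  rewrite unitmxE unitfE det_Vandermonde.
  apply/prodf_neq0 => i _; apply/prodf_neq0 => j ij.
  rewrite !mxE subr_eq0 (inj_eq (addrI _)) nth_uniq// neq_ltn.
  by rewrite ij orbT.
pose My := map_mx (leval_at y1) M.
(* Column k of [W] is an eigenvector of [My] for the value of [g] at z + u_k: all the points z + u
   share the same psi z, hence the same matrix [My]. *)
have MW : My *m W = W *m diag_mx G.
  apply/matrixP => i k; rewrite mul_mx_diag !mxE.
  have [k1 ky k0] := lamP k.
  transitivity (\sum_(j < Q) lam 0 k ^+ j * leval iK (m i j) psi.[z]).
    by apply: eq_bigr => j _; rewrite !mxE mulrC.
  have := mP i (lam 0 k) k1; rewrite ky => /(_ y0) <-.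
  by rewrite levalM ?k0 ?k1// leval_lmono rmorph1 mul1r mxE.
have MyE : My = W *m diag_mx G *m invmx W by rewrite -MW mulmxK.
split.
  have -> : leval iK (\tr M) psi.[z] = \tr My by rewrite trace_map_mx.
  rewrite MyE mxtrace_mulC mulKmx// mxtrace_diag (big_nth 0) big_mkord.
  by apply: eq_bigr => i _; rewrite !mxE.
have -> : leval iK (\det M) psi.[z] = \det My by rewrite det_map_mx.
rewrite MyE !det_mulmx mulrAC -det_mulmx mulmxV// det1 mul1r det_diag.
by rewrite (big_nth 0) big_mkord; apply: eq_bigr => i _; rewrite !mxE.
Qed.

End Division.

(** * Continuity and uniqueness *)

Lemma filter_forall_seq (T : Type) (I : eqType) (F : set_system T) (s : seq I)
    (P : I -> set T) : Filter F -> (forall i, i \in s -> F (P i)) ->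
  F [set a | forall i, i \in s -> P i a].
Proof.
move=> FF; elim: s => [|i s IH] FP; first exact: (@filterE _ F FF).
have Fs := IH (fun j js => FP j (mem_behead (s := i :: s) js)).
have H := @filterI _ F FF _ _ (FP i (mem_head i s)) Fs.
apply: filterS H => a [Pi Ps] j; rewrite in_cons => /orP[/eqP ->//|]; exact: Ps.
Qed.

Section PeriodicOperators.
Variables (R : realType) (K : fieldType) (C : naFieldType R).
Variable iK : {rmorphism K -> C}.
Variables (psi : {poly C}) (V : seq C).
Hypothesis psiV : psi = \prod_(u <- V) ('X - u%:P).
Hypothesis V_uniq : uniq V.
Hypothesis V_lt1 : forall u, u \in V -> absv u < 1.
Hypothesis V0 : 0 \in V.
Hypothesis psiD : forall x y, psi.[x + y] = psi.[x] + psi.[y].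
Hypothesis psi_surj : forall w, absv w < 1 -> exists2 z, absv z < 1 & psi.[z] = w.
Hypothesis small : exists x : C, 0 < absv x < 1.

Let psi_rootE u : (psi.[u] == 0) = (u \in V).
Proof. by rewrite psiV -rootE root_prod_XsubC. Qed.

Let psi0 : psi.[0] = 0.
Proof. by apply/eqP; rewrite psi_rootE. Qed.

Let VN u : u \in V -> - u \in V.
Proof.
rewrite -!psi_rootE => /eqP u0.
by rewrite -[psi.[- u]]add0r -{1}u0 -psiD subrr psi0.
Qed.

Let VD u v : u \in V -> v \in V -> u + v \in V.
Proof. by rewrite -!psi_rootE psiD => /eqP -> /eqP ->; rewrite addr0. Qed.

Let psi_translate z u : u \in V -> psi.[z + u] = psi.[z].
Proof. by rewrite -psi_rootE psiD => /eqP ->; rewrite addr0. Qed.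

Lemma translate_ball z u : absv z < 1 -> psi.[z] != 0 -> u \in V ->
  0 < absv (z + u) < 1.
Proof.
move=> z1 y0 uV; apply/andP; split; last by rewrite absv_lt_max// V_lt1.
by rewrite absv_gt0; apply: contraNneq y0 => zu; rewrite -(psi_translate z uV) zu psi0.
Qed.

(** Take a preimage of least absolute value in its coset of the finite group [V]. Minimality
    excludes cancellation in z + u when |z| = |u|, the only case in which the ultrametric inequality
    leaves |z + u| open. *)
Lemma min_preimage w : absv w < 1 -> exists z,
  [/\ psi.[z] = w, absv z < 1 &
      forall u, u \in V -> absv (z + u) = Num.max (absv z) (absv u)].
Proof.
move=> /psi_surj[z0 z01 z0w].
have V0i : (index 0%R V < size V)%N by rewrite index_mem.
case: (@Order.TotalTheory.arg_minP _ R _ (Ordinal V0i) xpredT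
  (fun i => absv (z0 + V`_i)) isT) => i _ imin; have iV : V`_i \in V by rewrite mem_nth.
exists (z0 + V`_i); split => [||u uV]; first by rewrite psi_translate.
  by rewrite absv_lt_max// V_lt1.
have zu : absv (z0 + V`_i) <= absv (z0 + V`_i + u).
  have uV' : V`_i + u \in V by exact: VD.
  have ui : (index (V`_i + u)%R V < size V)%N by rewrite index_mem.
  by have := imin (Ordinal ui) isT; rewrite /= nth_index// addrA.
have [h|h|h] := ltgtP (absv (z0 + V`_i)) (absv u).
- by rewrite addrC absvDl.
- exact: absvDl.
- by apply/le_anti; rewrite zu andbT absvD_le// h.
Qed.

(** Strictness comes from the factor u = 0. For the minimal preimages z, the product with d = |z| is
    |psi z|, so |psi z| determines |z|. *)
Lemma prod_max_lt (d d' : R) : 0 < d -> d < d' ->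
  \prod_(u <- V) Num.max d (absv u) < \prod_(u <- V) Num.max d' (absv u).
Proof.
move=> d0 dd'; rewrite !(big_rem 0 V0)/= absv0 !max_l ?(ltW d0) ?(ltW (lt_trans d0 dd'))//.
have P0 : 0 < \prod_(u <- rem 0 V) Num.max d (absv u).
  by apply: prodr_gt0 => u _; rewrite lt_max d0.
apply: (@lt_le_trans _ _ (d' * \prod_(u <- rem 0 V) Num.max d (absv u))).
  by rewrite ltr_pM2r.
apply: ler_wpM2l; [by rewrite ltW// (lt_trans d0)|apply: ler_prod => u _].
by rewrite le_max ltW//= ge_max !le_max lexx orbT (ltW dd').
Qed.

(* By the ultrametric inequality the points [z + u] over a sphere [|psi z| = s]
   lie on finitely many spheres, so no maximum principle is needed to bound the
   seminorms of the operators. *)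
Lemma sphere_preimage (w0 : C) : 0 < absv w0 < 1 -> exists x : C,
  0 < absv x < 1 /\ forall w, absv w = absv w0 -> exists z,
    [/\ psi.[z] = w, absv z < 1 &
        forall u, u \in V -> absv (z + u) = Num.max (absv x) (absv u)].
Proof.
move=> /andP[w00 w01]; have [x [xw0 x1 xV]] := min_preimage w01.
have norm_psi z : (forall u, u \in V -> absv (z + u) = Num.max (absv z) (absv u)) ->
    absv psi.[z] = \prod_(u <- V) Num.max (absv z) (absv u).
  move=> zV; rewrite psiV horner_prod absv_prod big_seq [RHS]big_seq.
  by apply: eq_bigr => u uV; rewrite hornerXsubC zV ?VN// absvN.
have gt0 z w : absv w = absv w0 -> psi.[z] = w -> 0 < absv z.
  move=> ww0 zw; rewrite absv_gt0; apply: contraTneq w00 => z0.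
  by rewrite -ww0 -zw z0 psi0 absv0 ltxx.
exists x; split => [|w ww0]; first by rewrite (gt0 _ w0)// x1.
have w1 : absv w < 1 by rewrite ww0.
have [z [zw z1 zV]] := min_preimage w1.
suff zx : absv z = absv x by exists z; split=> // u /zV ->; rewrite zx.
have := ww0; rewrite -zw -xw0 !norm_psi//.
have z0 := gt0 _ _ ww0 zw; have x0 := gt0 _ _ erefl xw0.
by case: (ltgtP (absv z) (absv x)) => // /prod_max_lt => [/(_ z0)|/(_ x0)] /[swap] ->;
  rewrite ltxx.
Qed.

Lemma lseminorm_ge0 (g : laurent iK) (r : R) : 0 < r < 1 -> (exists z : C, absv z = r) ->
  0 <= lseminorm r g.
Proof. by move=> r1 [z zr]; rewrite (le_trans (absv_ge0 _) (le_lseminorm g r1 zr)). Qed.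

(** Treats trace and norm together: [Psi] is the sum or the product over [V]. The seminorm of T a -
    T g on one sphere is controlled by the seminorms of a - g at the finitely many radii max (|x|,
    |u|) of [sphere_preimage]. *)
Lemma periodic_continuous (Psi : (C -> C) -> C) (T : laurent iK -> laurent iK) :
  (forall M e : R, 1 <= M -> 0 < e -> exists2 d : R, 0 < d & forall F G : C -> C,
    (forall u, u \in V -> absv (G u) <= M) ->
    (forall u, u \in V -> absv (F u - G u) <= d) ->
    absv (Psi F - Psi G) <= e) ->
  (forall (g : laurent iK) (z : C), absv z < 1 -> psi.[z] != 0 ->
    Psi (fun u => leval iK g (z + u)) = leval iK (T g) psi.[z]) ->
  continuous T.
Proof.
move=> Psi_cont TP; apply: laurent_continuous => g s e s1 [w0 w0s] e0.
rewrite -{s}w0s in s1 *; have [x [x1 xP]] := sphere_preimage s1.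
have rV u : u \in V -> 0 < Num.max (absv x) (absv u) < 1.
  by move=> uV; rewrite lt_max gt_max; case/andP : x1 => -> ->; rewrite V_lt1.
have rE (u : C) : exists z : C, absv z = Num.max (absv x) (absv u).
  by rewrite /Num.max; case: ifP => _; [exists u|exists x].
pose M := 1 + \sum_(u <- V) lseminorm (Num.max (absv x) (absv u)) g.
have sV u : u \in V -> 0 <= lseminorm (Num.max (absv x) (absv u)) g.
  by move=> uV; apply: lseminorm_ge0 => //; exact: rV.
have M1 : 1 <= M by rewrite lerDl big_seq sumr_ge0.
have gM u : u \in V -> lseminorm (Num.max (absv x) (absv u)) g <= M.
  move=> uV; rewrite /M (big_rem u uV)/= addrCA lerDl addr_ge0//.
  rewrite big_seq sumr_ge0// => v vV.
  by rewrite sV// (mem_rem vV).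
(* Half of [e], since bounding a supremum yields only a weak inequality. *)
have [d d0 dP] := Psi_cont M (e / 2) M1 (divr_gt0 e0 (ltr0n _ 2)).
have H : nbhs g [set a | forall u, u \in V ->
    lseminorm (Num.max (absv x) (absv u)) (a - g) < d].
  apply: filter_forall_seq => u uV.
  by apply: lseminorm_nbhs => //; exact: rV.
apply: filterS H => a /= aV.
apply: (@le_lt_trans _ _ (e / 2)); last by rewrite ltr_pdivrMr// ltr_pMr// ltr1n.
apply: lseminorm_le => [|w ww0]; first by exists w0.
have [z [zw z1 zV]] := xP w ww0.
have w1 : 0 < absv w < 1 by rewrite ww0.
have y0 : psi.[z] != 0 by rewrite zw absv_neq0//; case/andP : w1.
rewrite levalB// -zw -!TP//; apply: dP => u uV.
  by rewrite (le_trans _ (gM u uV))// le_lseminorm ?rV ?zV.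
have zu := translate_ball z1 y0 uV.
by rewrite -levalB// (le_trans _ (ltW (aV u uV)))// le_lseminorm ?rV ?zV.
Qed.

Lemma periodic_unique (T T' : laurent iK -> laurent iK) :
  (forall (g : laurent iK) (z : C), absv z < 1 -> psi.[z] != 0 ->
    leval iK (T g) psi.[z] = leval iK (T' g) psi.[z]) -> T = T'.
Proof.
move=> TT'; apply/funext => g; apply: laurent_ext => // w /andP[w0 w1].
by have [z z1 zw] := psi_surj w1; rewrite -zw TT'// zw absv_neq0.
Qed.

Lemma trace_norm_operators :
  (forall g : laurent iK, exists t n : laurent iK,
    forall z, absv z < 1 -> psi.[z] != 0 ->
      \sum_(u <- V) leval iK g (z + u) = leval iK t psi.[z] /\
      \prod_(u <- V) leval iK g (z + u) = leval iK n psi.[z]) ->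
  exists T N : laurent iK -> laurent iK,
    [/\ unique (fun T => continuous T /\ is_trace_operator psi [set` V] T) T,
        unique (fun N => continuous N /\ is_norm_operator psi [set` V] N) N,
        {morph T : g h / g + h},
        {in GRing.unit, forall g, N g \is a GRing.unit} &
        {in GRing.unit &, {morph N : g h / g * h}}].
Proof.
move=> /choice[T /choice[N TN]].
have TP : is_trace_operator psi [set` V] T.
  by move=> g z z1 y0; rewrite -fsbig_seq//; case: (TN g z z1 y0).
have NP : is_norm_operator psi [set` V] N.
  by move=> g z z1 y0; rewrite -fsbig_seq//; case: (TN g z z1 y0).
have NM : {morph N : g h / g * h}.
  move=> g h; apply: laurent_ext => // w /andP[w0 w1].
  have [z z1 zw] := psi_surj w1.
  have y0 : psi.[z] != 0 by rewrite zw absv_neq0.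
  rewrite levalM ?w0// -zw.
  have [_ <-] := TN (g * h) z z1 y0; have [_ <-] := TN g z z1 y0.
  have [_ <-] := TN h z z1 y0; rewrite -big_split big_seq [RHS]big_seq.
  by apply: eq_bigr => u uV; rewrite levalM// translate_ball.
have N1 : N 1 = 1.
  apply: laurent_ext => // w /andP[w0 w1]; have [z z1 zw] := psi_surj w1.
  have y0 : psi.[z] != 0 by rewrite zw absv_neq0.
  rewrite leval1 -zw; have [_ <-] := TN 1 z z1 y0.
  by apply: big1 => u _; exact: leval1.
exists T, N; split.
- split=> [|T' [_ T'P]]; last first.
    by apply: periodic_unique => g z z1 y0; rewrite -TP// T'P.
  split=> //; apply: (@periodic_continuous (fun F => \sum_(u <- V) F u)).
    move=> M e _ e0; exists e => // F G _ FG.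
    by rewrite -sumrB big_seq absv_sum_le// ltW.
  by move=> g z z1 y0; case: (TN g z z1 y0).
- split=> [|N' [_ N'P]]; last first.
    by apply: periodic_unique => g z z1 y0; rewrite -NP// N'P.
  split=> //; apply: (@periodic_continuous (fun F => \prod_(u <- V) F u)).
    move=> M e M1 e0; have M0 : 0 < M := lt_le_trans ltr01 M1.
    (* [absv_prodB] requires d <= M and gives the error d * M ^ (size V), which must not exceed
       e. *)
    exists (Num.min M (e / M ^+ size V)).
      by rewrite lt_min M0 divr_gt0// exprn_gt0.
    move=> F G GM FG; have d0 : 0 <= Num.min M (e / M ^+ size V).
      by rewrite le_min !ltW// divr_gt0// exprn_gt0.
    rewrite (le_trans (absv_prodB M1 d0 _ GM FG)) ?ge_min ?lexx//.
    by rewrite -ler_pdivlMr ?exprn_gt0// ge_min lexx orbT.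
  by move=> g z z1 y0; case: (TN g z z1 y0).
- move=> g h; apply: laurent_ext => // w /andP[w0 w1].
  have [z z1 zw] := psi_surj w1.
  have y0 : psi.[z] != 0 by rewrite zw absv_neq0.
  rewrite levalD ?w0// -zw.
  have [<- _] := TN (g + h) z z1 y0; have [<- _] := TN g z z1 y0.
  have [<- _] := TN h z z1 y0; rewrite -big_split big_seq [RHS]big_seq.
  by apply: eq_bigr => u uV; rewrite levalD// translate_ball.
- move=> g gu; apply/unitrP; exists (N g^-1).
  by rewrite -!NM mulVr// mulrV.
- by move=> g h _ _; exact: NM.
Qed.

End PeriodicOperators.

(** * Additive polynomials and torsion points *)

Lemma closed_field_split (L : fieldType) : GRing.closed_field_axiom L ->
  forall q : {poly L}, q \is monic -> exists s, q = \prod_(a <- s) ('X - a%:P).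
Proof.
move=> L_closed q; move: {2}(size q) (leqnn (size q)) => n.
elim: n q => [|n IH] q.
  by rewrite leqn0 size_poly_eq0 => /eqP -> /monic_neq0; rewrite eqxx.
move=> qn qm; have [|q1] := leqP (size q) 1.
  move=> /size1_polyC; move: (q`_0) => c qE; exists [::].
  by move: qm; rewrite big_nil qE monicE lead_coefC => /eqP ->.
have [x xq] : exists x, root q x.
  have q0 : (0 < (size q).-1)%N by lia.
  have [x xE] := L_closed (size q).-1 (fun i => - q`_i) q0.
  exists x; apply/rootP; rewrite horner_coef -(prednK (ltnW q1)) big_ord_recr /=.
  have -> : q`_(size q).-1 = 1 by apply/eqP; rewrite -lead_coefE -monicE.
  rewrite mul1r xE -big_split big1//= => i _.
  by rewrite mulNr subrr.
have /factor_theorem[h hE] := xq.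
have hm : h \is monic by move: qm; rewrite hE monicMr ?monicXsubC.
have hn : (size h <= n)%N.
  move: qn; rewrite hE size_Mmonic ?monicXsubC ?monic_neq0// size_XsubC addn2.
  by rewrite ltnS.
have [s sE] := IH h hn hm; exists (x :: s).
by rewrite big_cons hE sE mulrC.
Qed.

Lemma prod_seq_has_le (R : realDomainType) (I : eqType) (s : seq I) (F : I -> R)
    (t : R) : 0 <= t -> (0 < size s)%N -> \prod_(i <- s) F i <= t ^+ size s ->
  exists2 i, i \in s & F i <= t.
Proof.
move=> t0 s0 Ft; apply/hasP; apply: contraPT Ft => /hasPn sF.
apply/negP; rewrite -ltNge; elim: s s0 sF => // i s IH _ sF.
have Fi : t < F i by rewrite ltNge sF ?mem_head.
rewrite big_cons exprS /=; case: s IH sF => [|j s] IH sF.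
  by rewrite big_nil expr0 !mulr1.
have {}IH := IH isT (fun k ks => sF k (mem_behead (s := i :: j :: s) ks)).
apply: (@le_lt_trans _ _ (t * \prod_(k <- j :: s) F k)); first by rewrite ler_wpM2l// ltW.
by rewrite ltr_pM2r// (le_lt_trans _ IH)// exprn_ge0.
Qed.

Section AdditiveSurjective.
Variables (R : realType) (L : fieldType) (C : naFieldType R) (j : {rmorphism L -> C}).
Hypothesis L_closed : GRing.closed_field_axiom L.
Hypothesis L_dense : dense (range j).
Hypothesis C_complete :
  forall G : set_system C, ProperFilter G -> cauchy G -> cvg G.
Variables (q : {poly L}) (V : seq C).
Local Notation psi := (map_poly j q).
Hypothesis qV : psi = \prod_(u <- V) ('X - u%:P).
Hypothesis V0 : 0 \in V.
Hypothesis psiD : forall x y, psi.[x + y] = psi.[x] + psi.[y].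

Let psi_horner (z : C) : psi.[z] = \prod_(u <- V) (z - u).
Proof. by rewrite qV horner_prod_XsubC. Qed.

Let V_gt0 : (0 < size V)%N.
Proof. by case: V V0. Qed.

(** The roots of q - w in [L] are [size V] in number and multiply to w up to sign, so they cannot
    all violate the bound. *)
Lemma small_preimage (w : L) : exists z : L,
  q.[z] = w /\ absv (j z) ^+ size V <= absv (j w).
Proof.
have qm : q \is monic.
  by rewrite -(map_monic j) qV monic_prod_XsubC.
have qsz : size q = (size V).+1.
  by rewrite -(size_map_poly j) qV size_prod_XsubC.
have wq : (size (- w%:P) < size q)%N.
  by rewrite size_polyN qsz (leq_ltn_trans (size_polyC_leq1 _)).
have qwm : q - w%:P \is monic by rewrite monicE lead_coefDl// -monicE.
have [s sE] := closed_field_split L_closed qwm.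
have ssz : size s = size V.
  by have := size_prod_XsubC s id; rewrite -sE size_polyDl// qsz => -[].
have q0 : q.[0] = 0.
  apply: (fmorph_inj j); rewrite -horner_map !rmorph0 /= psi_horner (big_rem 0 V0) /=.
  by rewrite subrr mul0r.
have prods : \prod_(a <- s) absv (j a) = absv (j w).
  have := congr1 (fun h : {poly L} => absv (j h.[0])) sE.
  rewrite /= hornerD hornerN hornerC q0 sub0r rmorphN absvN horner_prod_XsubC.
  rewrite rmorph_prod absv_prod => ->.
  by apply: eq_bigr => a _; rewrite sub0r rmorphN absvN.
have [||| a sa aw] := @prod_seq_has_le _ _ s (fun a => absv (j a) ^+ size V) (absv (j w)).
- exact: absv_ge0.
- by rewrite ssz.
- by rewrite prodrXl prods ssz.
exists a; split=> //; apply/subr0_eq.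
have : root (q - w%:P) a by rewrite sE root_prod_XsubC.
by rewrite rootE hornerD hornerN hornerC => /eqP.
Qed.

Hypothesis V_lt1 : forall u, u \in V -> absv u < 1.

Lemma psi_contract z : absv z <= 1 -> absv psi.[z] <= absv z.
Proof.
move=> z1; rewrite psi_horner (big_rem 0 V0)/= subr0 absvM -[leRHS]mulr1.
apply: ler_wpM2l; rewrite ?absv_ge0// absv_prod -[leRHS](expr1n R (size (rem 0 V))).
apply: prod_seq_le => u uV; rewrite absv_ge0/= absvD_le// absvN ltW// V_lt1//.
exact: mem_rem uV.
Qed.

(** Only [L] is known to be algebraically closed. Approximating w from [L] writes it as a sum of
    elements t_n tending to 0; their small preimages tend to 0 too, so they can be summed in [C].
    Additivity and [psi_contract], which is continuity at 0, show that the sum is a preimage of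
    w. *)
Lemma additive_surjective (w : C) : absv w < 1 ->
  exists2 z, absv z < 1 & psi.[z] = w.
Proof.
move=> w1; have e_gt0 n : 0 < 2^-1 ^+ n :> R by rewrite exprn_gt0 ?invr_gt0.
have approx (n : nat) : exists x : L, absv (w - j x) < 2^-1 ^+ n.
  have [|x [/interior_subset wx [y _ yx]]] :=
      L_dense _ (@open_interior _ (ball w (2^-1 ^+ n))).
    by exists w; apply: nbhsx_ballx.
  by exists y; rewrite yx.
have [x xw] := choice approx.
pose t n := if n is m.+1 then x n - x m else x 0%N.
have [z zt] := choice small_preimage.
have tE n : \sum_(i < n.+1) t i = x n.
  by elim: n => [|n IH]; rewrite ?big_ord1// big_ord_recr /= IH addrC subrK.
have tn n : absv (j (t n.+1)) < 2^-1 ^+ n.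
  rewrite rmorphB [X in absv X](_ : _ = (w - j (x n)) - (w - j (x n.+1))); last by ring.
  rewrite absv_lt_maxB// (lt_le_trans (xw _))// exprS ler_piMl ?ltW// invf_lt1//.
  by rewrite ltr1n.
have znull : na_null (fun n => j (z (t n))).
  move=> e e0; have eV : 0 < e ^+ size V by rewrite exprn_gt0.
  have h : 0 <= (2^-1 : R) < 1 by rewrite invr_ge0 ler0n invf_lt1// ltr1n.
  have [N Nh] := geometric_null 1 h eV; exists N.+1 => -[//|n] Nn.
  have [_ zn] := zt (t n.+1).
  rewrite -(ltr_pXn2r V_gt0) ?nnegrE ?absv_ge0 ?ltW//.
  by rewrite (le_lt_trans zn)// (lt_trans (tn _))// -[ltLHS]mul1r Nh.
have [y ys] := na_null_sums C_complete znull.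
have psi_sum n : psi.[(\sum_(i < n.+1) j (z (t i)))] = j (x n).
  rewrite -(tE n) rmorph_sum (big_morph (horner psi) psiD (_ : psi.[0] = 0)).
    by apply: eq_bigr => i _; rewrite horner_map; have [-> _] := zt (t i).
  by rewrite psi_horner (big_rem 0 V0)/= subrr mul0r.
have yw : psi.[y] = w.
  apply/subr0_eq/absv_le0 => e e0; have e1 : 0 < Num.min e 1 by rewrite lt_min e0 ltr01.
  have h : 0 <= (2^-1 : R) < 1 by rewrite invr_ge0 ler0n invf_lt1// ltr1n.
  have [N1 h1] := geometric_null 1 h e0; have [N2 h2] := (sumsP _ _).1 ys _ e1.
  pose n := maxn N1 N2.
  have := h2 n.+1; rewrite (leq_trans (leq_maxr N1 N2))// => /(_ isT).
  set s := \sum_(i < n.+1) _ => ys_n.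
  move: ys_n; rewrite lt_min => /andP[/ltW yse /ltW ys1].
  rewrite -(subrK s y) psiD psi_sum -addrA; apply: absvD_le.
    exact: le_trans (psi_contract ys1) yse.
  by rewrite absv_distC ltW// (lt_trans (xw _))// -[ltLHS]mul1r h1// leq_maxl.
exists y => //; rewrite ltNge; apply/negP => y1; move: w1; apply/negP.
rewrite -leNgt -yw psi_horner absv_prod big_seq.
rewrite (eq_bigr (fun=> absv y)) => [|u uV]; last first.
  by rewrite absvDl// absvN (lt_le_trans (V_lt1 uV)).
by rewrite -big_seq big_const_seq iter_mulr_1 exprn_ege1.
Qed.

End AdditiveSurjective.

(** * Skew polynomials as additive maps *)

Section TauEval.
Variables (q : nat) (H C : fieldType) (iH : {rmorphism H -> C}).
Hypothesis qC : [pchar C].-nat q.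
Hypothesis q_gt1 : (1 < q)%N.
Implicit Types c d : {poly H}.

Definition tau_eval c (z : C) := (map_poly iH (tau_poly q c)).[z].

Lemma tau_evalE n c z : (size c <= n)%N ->
  tau_eval c z = \sum_(i < n) iH c`_i * z ^+ (q ^ i).
Proof.
move=> cn; rewrite /tau_eval /tau_poly rmorph_sum horner_sum -(subnKC cn).
rewrite big_split_ord /= [X in _ = _ + X]big1 ?addr0 => [|i _].
  by apply: eq_bigr => i _; rewrite map_polyZ map_polyXn hornerZ hornerXn.
by rewrite nth_default ?leq_addr// rmorph0 mul0r.
Qed.

Lemma frobeniusD i (x y : C) : (x + y) ^+ (q ^ i) = x ^+ (q ^ i) + y ^+ (q ^ i).
Proof. by rewrite exprDn_pchar// pnatX qC. Qed.

Lemma frobenius_sum i (I : Type) (r : seq I) (F : I -> C) :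
  (\sum_(k <- r) F k) ^+ (q ^ i) = \sum_(k <- r) F k ^+ (q ^ i).
Proof.
apply: (big_morph (fun x => x ^+ (q ^ i)) (frobeniusD i)).
by rewrite expr0n expn_eq0 -leqn0 leqNgt (ltnW q_gt1).
Qed.

Lemma tau_evalD c z w : tau_eval c (z + w) = tau_eval c z + tau_eval c w.
Proof.
rewrite !(tau_evalE _ (leqnn _)) -big_split.
by apply: eq_bigr => i _; rewrite frobeniusD mulrDr.
Qed.

Lemma tau_eval0 c : tau_eval c 0 = 0.
Proof. by apply: (addrI (tau_eval c 0)); rewrite -tau_evalD !addr0. Qed.

Lemma tau_eval_add c d z : tau_eval (c + d) z = tau_eval c z + tau_eval d z.
Proof.
pose n := maxn (size c) (size d).
rewrite (tau_evalE (n := n)) ?size_polyD// !(tau_evalE (n := n)) ?leq_maxl ?leq_maxr//.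
by rewrite -big_split; apply: eq_bigr => i _; rewrite coefD rmorphD mulrDl.
Qed.

Lemma tau_eval_mul c d z : tau_eval (tau_mul q c d) z = tau_eval c (tau_eval d z).
Proof.
pose F i k : C := iH c`_i * (iH d`_k * z ^+ (q ^ k)) ^+ (q ^ i).
have -> : tau_eval (tau_mul q c d) z =
    \sum_(m < size c + size d) \sum_(i < m.+1) F i (m - i)%N.
  rewrite (tau_evalE (n := size c + size d)) ?size_poly//.
  apply: eq_bigr => m _; rewrite coef_poly ltn_ord rmorph_sum mulr_suml.
  apply: eq_bigr => i _; rewrite rmorphM rmorphXn -mulrA /F exprMn -exprM -expnD.
  by rewrite subnK// -ltnS.
rewrite big_triangle (tau_evalE _ (leq_addr (size d) (size c))).
apply: eq_bigr => i _; have [ic|ci] := ltnP i (size c); last first.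
  rewrite nth_default// rmorph0 mul0r big1// => k _.
  by rewrite /F nth_default// rmorph0 mul0r.
(* As i < size c, the truncated range still covers all coefficients of d. *)
rewrite (tau_evalE (n := size c + size d - i)); last by lia.
by rewrite frobenius_sum mulr_sumr.
Qed.

Let q_eq0 : q%:R = 0 :> C.
Proof.
have pC : pdiv q \in [pchar C].
  by apply: (pnatPpi qC); rewrite pi_pdiv.
have [k ->] := dvdnP (pdiv_dvd q).
by rewrite natrM (pcharf0 pC) mulr0.
Qed.

(** Only the term i = 0 survives, as q = 0 in [C]. This gives both the separability of [psi] and the
    product of its nonzero zeros. *)
Lemma tau_poly_deriv c : (map_poly iH (tau_poly q c))^`() = (iH c`_0)%:P.
Proof.
rewrite /tau_poly rmorph_sum raddf_sum /=; have [c0|c0] := posnP (size c).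
  by rewrite c0 big_ord0 nth_default ?c0// rmorph0.
rewrite -(prednK c0) big_ord_recl big1 ?addr0 => [|i _].
  by rewrite map_polyZ map_polyXn derivZ /= expr1 derivX -mul_polyC mulr1.
rewrite map_polyZ map_polyXn derivZ derivXn /= -mulr_natr natrX.
by rewrite -polyC_natr q_eq0 expr0n/= mulr0 scaler0.
Qed.

Lemma tau_poly_size c : c != 0 -> size (tau_poly q c) = (q ^ (size c).-1).+1.
Proof.
rewrite -size_poly_gt0 => c0; rewrite /tau_poly -(prednK c0) big_ord_recr /=.
rewrite addrC size_polyDl size_scale ?size_polyXn//;
  rewrite -?lead_coefE ?lead_coef_eq0 -?size_poly_gt0//.
apply: leq_trans (size_sum _ _ _) _; apply/bigmax_leqP => i _.
by rewrite (leq_trans (size_scale_leq _ _))// size_polyXn ltn_exp2l.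
Qed.

Lemma tau_poly_monic c : c \is monic -> tau_poly q c \is monic.
Proof.
move=> cm; have c0 := monic_neq0 cm.
rewrite monicE /lead_coef tau_poly_size//= /tau_poly.
move: c0 cm; rewrite -size_poly_gt0 monicE lead_coefE.
case: (size c) => // n _ /= /eqP cn.
rewrite big_ord_recr /= cn scale1r coefD coefXn eqxx coef_sum big1 ?add0r// => i _.
by rewrite coefZ coefXn gtn_eqF ?mulr0// ltn_exp2l.
Qed.

End TauEval.

(* A point [m] of the open ball with [eta^2 m = 0 != eta m] has a multiple [n]
   whose annihilator is exactly [eta A]; then the [Q] points [x n], [x] running
   through [A / eta], exhaust the [Q] elements of [V]. *)
Section TorsionBall.
Variables (R : realType) (C : naFieldType R) (A : comNzRingType).
Variables (act : A -> C -> C) (eta pi : A) (V : seq C) (xs : seq A) (f : nat).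
Hypothesis actD : forall a z w, act a (z + w) = act a z + act a w.
Hypothesis act_add : forall a b z, act (a + b) z = act a z + act b z.
Hypothesis act_mul : forall a b z, act (a * b) z = act a (act b z).
Hypothesis act_lt1 : forall a z, absv z < 1 -> absv (act a z) < 1.
Hypothesis VP : forall u, (u \in V) = (act eta u == 0).
Hypothesis xs_size : (size V <= size xs)%N.
Hypothesis xs_incong : forall i j, (i < j < size xs)%N ->
  ~ principal eta (xs`_j - xs`_i).
Hypothesis pi_nil : principal eta (pi ^+ f).
Hypothesis pi_unif : forall x, principal eta x \/
  exists k y b, x * y * pi ^+ k.+1 = eta + eta * eta * b.

Let act0 a : act a 0 = 0.
Proof. by apply: (addrI (act a 0)); rewrite -actD !addr0. Qed.

Lemma torsion_lt1 (m : C) : absv m < 1 -> act eta m != 0 ->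
  act eta (act eta m) = 0 -> forall u, u \in V -> absv u < 1.
Proof.
move=> m1 em0 eem0.
have ex : exists i, act eta (act (pi ^+ i) m) == 0.
  exists f; have [b ->] := pi_nil.
  by rewrite -act_mul mulrCA !act_mul eem0 act0.
(* With i least, eta kills n = pi ^ i m but does not kill pi ^ (i - 1) m. *)
case: (ex_minnP ex) => i /eqP eni imin; pose n := act (pi ^+ i) m.
have i0 : (0 < i)%N.
  rewrite lt0n; apply: contraNneq em0 => i0.
  by move: eni; rewrite i0 expr0 -act_mul mulr1 => ->.
(* Otherwise x y pi ^ (k + 1) is congruent to eta modulo eta ^ 2, which kills m; applied to pi ^ (i
   - 1) m this gives eta pi ^ (i - 1) m = y pi ^ k x n = 0, against the minimality of i. *)
have annP x : act x n = 0 -> principal eta x.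
  move=> xn; have [//|[k [y [b xyE]]]] := pi_unif x.
  suff : act eta (act (pi ^+ i.-1) m) == 0 by move=> /imin; rewrite leqNgt ltn_predL i0.
  have -> : act eta (act (pi ^+ i.-1) m) =
      act (eta + eta * eta * b) (act (pi ^+ i.-1) m).
    have -> : act (eta + eta * eta * b) (act (pi ^+ i.-1) m) =
        act eta (act (pi ^+ i.-1) m) + act (b * pi ^+ i.-1 * (eta * eta)) m.
      by rewrite act_add -[in X in _ + X]act_mul; congr (_ + act _ m); ring.
    by rewrite act_mul (act_mul eta eta) eem0 act0 addr0.
  rewrite -xyE -act_mul (_ : _ * _ = y * pi ^+ k * (x * pi ^+ i)).
    by rewrite act_mul (act_mul x) -/n xn act0.
  by rewrite -[in RHS](prednK i0) !exprS; ring.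
have act_sub x y z : act (x - y) z = act x z - act y z.
  by apply/eqP; rewrite eq_sym subr_eq -act_add subrK.
pose us := [seq act x n | x <- xs].
have us_uniq : uniq us.
  apply/(uniqP 0) => a b; rewrite !inE size_map => asz bsz.
  rewrite !(nth_map 0)// => ab.
  have [h|h|//] := ltngtP a b.
    have : principal eta (xs`_b - xs`_a) by apply: annP; rewrite act_sub ab subrr.
    by move=> ?; case: (@xs_incong a b) => //; rewrite h.
  have : principal eta (xs`_a - xs`_b) by apply: annP; rewrite act_sub ab subrr.
  by move=> ?; case: (@xs_incong b a) => //; rewrite h.
have us_V : {subset us <= V}.
  move=> _ /mapP[x _ ->]; rewrite VP -act_mul mulrC act_mul.
  by rewrite /n eni act0.
have us_size : (size V <= size us)%N by rewrite size_map.
move=> u uV; have [_ usV] := uniq_min_size us_uniq us_V us_size.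
move: uV; rewrite -usV => /mapP[x _ ->].
by apply/act_lt1/act_lt1.
Qed.

End TorsionBall.

(** * The adic place on [A] *)

Lemma residue_reps (A : comNzRingType) (eta : A) m :
  (residue_classes (principal eta) #= `I_m)%card ->
  exists xs : seq A, [/\ size xs = m,
    forall i j, (i < j < size xs)%N -> ~ principal eta (xs`_j - xs`_i) &
    forall x, exists2 i, (i < size xs)%N & principal eta (x - xs`_i)].
Proof.
rewrite card_eq_sym => /(@pcard_eqP _ (set A))/unsquash g.
have gP i : exists x : A, (i < m)%N -> g i = [set y | principal eta (y - x)].
  have [im|_] := ltnP i m; last by exists 0.
  by have [x _ xE] := funS (s := g) i im; exists x => _; rewrite -xE.
have [x xP] := choice gP.
have prin0 : principal eta 0 by exists 0; rewrite mul0r.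
have nthx i : (i < m)%N -> (mkseq x m)`_i = x i by move=> im; rewrite nth_mkseq.
exists (mkseq x m); rewrite size_mkseq; split => // [i j /andP[ij jm]|y].
  have im := ltn_trans ij jm; rewrite !nthx// => -[b bE].
  have /(inj (f := g)) : g i = g j.
    rewrite !xP//; apply/seteqP; split => z [c cE].
      by exists (c - b); rewrite mulrBl -bE -cE; ring.
    by exists (c + b); rewrite mulrDl -bE -cE; ring.
  by move=> /(_ (mem_set im) (mem_set jm)) ijE; move: ij; rewrite ijE ltnn.
have [|i /= im gi] := surj (f := g) (t := [set z | principal eta (z - y)]).
  by exists y.
exists i => //; rewrite nthx//.
suff : (g i) y by rewrite xP.
by rewrite gi /= subrr.
Qed.

Section PlaceTheory.
Variables (F : fieldType) (v : place F).

Definition place_ge (n : int) (x : F) := (x == 0) || (n <= v x).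

Lemma place_geD n x y : place_ge n x -> place_ge n y -> place_ge n (x + y).
Proof.
rewrite /place_ge; have [->|x0] := eqVneq x 0; first by rewrite add0r.
have [->|y0] := eqVneq y 0; first by rewrite addr0 (negPf x0).
have [//|xy0] := eqVneq (x + y) 0; move=> /= nx ny.
by rewrite (le_trans _ (pvalD v x0 y0 xy0))// le_min nx.
Qed.

Lemma place_geM n m x y : place_ge n x -> place_ge m y -> place_ge (n + m) (x * y).
Proof.
rewrite /place_ge; have [->|x0] := eqVneq x 0; first by rewrite mul0r eqxx.
have [->|y0] := eqVneq y 0; first by rewrite mulr0 eqxx.
by move=> /= nx ny; rewrite pvalM// lerD ?orbT.
Qed.

Lemma place_exp x n : x != 0 -> v (x ^+ n) = v x *+ n.
Proof.
move=> x0; elim: n => [|n IH]; first by rewrite expr0 place1.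
by rewrite exprS mulrS pvalM ?expf_neq0// IH.
Qed.

End PlaceTheory.

Section AdicPlace.
Variables (F : fieldType) (oo : place F).
Local Notation A := (ringA oo).
Variables (P : prime_idealr A) (v : place F) (f : nat) (eta : A).
Hypothesis v_adic : is_adic_place [set` P] v.
Hypothesis f_gt0 : (0 < f)%N.
Hypothesis eta0 : eta != 0.
Hypothesis eta_gen : ideal_exp [set` P] f = principal eta.

Let val_neq0 (a : A) : a != 0 -> (a : F) != 0.
Proof. by apply: contraNneq => a0; apply/eqP/val_inj; rewrite /= a0. Qed.

Lemma adic_ge0 (a : A) : 0 <= v a.
Proof.
have [->|a0] := eqVneq a 0; first by rewrite pval0.
by apply/(v_adic 0 a0).
Qed.

Lemma adic_principal (a : A) : principal eta a <-> place_ge v f%:Z a.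
Proof.
have [->|a0] := eqVneq a 0.
  by split=> _; [rewrite /place_ge eqxx|exists 0; rewrite mul0r].
rewrite -eta_gen; apply: iff_trans (iff_sym (v_adic f a0)) _.
by rewrite /place_ge (negPf (val_neq0 a0)).
Qed.

(** If the valuation exceeded f, then eta would lie in P ^ (f + 1) = P eta; cancelling eta would put
    1 in P. *)
Lemma adic_eta : v eta = f%:Z.
Proof.
have fv : f%:Z <= v eta.
  by apply/(v_adic f eta0); rewrite eta_gen; exists 1; rewrite mul1r.
apply/eqP; rewrite eq_le fv andbT leNgt; apply/negP => vf.
have : f.+1%:Z <= v eta by lia.
move=> /(v_adic _ eta0); rewrite /ideal_exp iterS -/(ideal_exp _ f) eta_gen => -[s sP sE].
suff [p pP pE] : exists2 p : A, p \in P & \sum_(c <- s) c.1 * c.2 = p * eta.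
  have : (1 - p : A) * eta = 0 by rewrite mulrBl mul1r -pE -sE subrr.
  move=> /(congr1 (fun a : A => (a : F))) /= /eqP.
  rewrite mulf_eq0 (negPf (val_neq0 eta0)) orbF subr_eq0 => /eqP p1.
  have : (1 : A) \in P by rewrite (_ : 1 = p)//; apply: val_inj.
  by rewrite idealr1.
elim: s sP {sE} => [|c s IH] sP.
  by exists 0; rewrite ?idealr0// big_nil mul0r.
have [p pP pE] := IH (fun d ds => sP d (mem_behead (s := c :: s) ds)).
have [c1 [b c2]] := sP c (mem_head _ _).
exists (b * c.1 + p); first by rewrite rpredD// idealMr.
by rewrite big_cons pE c2; ring.
Qed.

(** The axiom [pval_onto] gives such an element only in [F]. If [A] had none, every nonzero element
    of P would have valuation at least 2, and eta in P ^ f at least 2 f instead of f. *)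
Lemma adic_uniformizer : exists2 pi : A, pi != 0 & v pi = 1.
Proof.
apply/not_exists2P => nopi.
have P2 (a : A) : a \in P -> place_ge v 2%:Z a.
  move=> aP; have [->|a0] := eqVneq a 0; first by rewrite /place_ge eqxx.
  rewrite /place_ge (negPf (val_neq0 a0))/=.
  have v1 : 1%:Z <= v a.
    apply/(v_adic 1 a0); exists [:: (a, 1)]; last by rewrite big_seq1 mulr1.
    by move=> c; rewrite inE => /eqP ->.
  by have [|va] := nopi a; [rewrite a0|have /eqP := va; lia].
have PX n (a : A) : ideal_exp [set` P] n a -> place_ge v (n.*2)%:Z a.
  elim: n a => [|n IH] a; first by rewrite /place_ge adic_ge0 orbT.
  move=> [s sP ->]; elim: s sP => [|c s IHs] sP.
    by rewrite big_nil /place_ge eqxx.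
  rewrite big_cons; apply: place_geD; last first.
    by apply: IHs => d ds; apply: sP; rewrite in_cons ds orbT.
  have [c1 c2] := sP c (mem_head _ _).
  rewrite (_ : n.+1.*2%:Z = 2%:Z + n.*2%:Z); last by lia.
  by apply: place_geM; [exact: P2|exact: IH].
have := PX f eta; rewrite eta_gen /place_ge (negPf (val_neq0 eta0)) adic_eta.
by move=> /(_ (ex_intro _ 1 (esym (mul1r _)))); lia.
Qed.

(** Multiplication by e is injective modulo eta, and two powers of e coincide in the finite ring A /
    eta; cancelling leaves a positive power of e congruent to 1. *)
Lemma adic_unit_mod (xs : seq A) (e : A) :
  (forall x, exists2 i, (i < size xs)%N & principal eta (x - xs`_i)) ->
  v e = 0 -> e != 0 -> exists e' b, e * e' = 1 + eta * b.
Proof.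
move=> xsP ve e0.
have e_reg (y : A) : principal eta (e * y) -> principal eta y.
  rewrite !adic_principal /place_ge /= mulf_eq0 (negPf (val_neq0 e0))/=.
  have [//|y0] := eqVneq (y : F) 0.
  by rewrite (pvalM v (val_neq0 e0) y0) ve add0r.
have /choice[g gP] : forall n : nat, exists i : nat,
    (i < size xs)%N /\ principal eta (e ^+ n - xs`_i).
  by move=> n; have [i ? ?] := xsP (e ^+ n); exists i.
pose h (n : 'I_(size xs).+1) : 'I_(size xs) := Ordinal (proj1 (gP n)).
have /injectivePn[a [b ab hab]] : ~~ injectiveb h.
  apply/negP => /injectiveP/leq_card; rewrite !card_ord ltnn//.
wlog ltab : a b ab hab / (a < b)%N.
  move=> H; have [/H|/H|/val_inj abE] := ltngtP a b; [exact|by apply; rewrite // eq_sym|].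
  by rewrite abE eqxx in ab.
have [c cE] : principal eta (e ^+ b - e ^+ a).
  have [_ [c1 c1E]] := gP a; have [_ [c2 c2E]] := gP b.
  have gab : g a = g b by have := congr1 val hab.
  exists (c2 - c1); rewrite mulrBl -c1E -c2E gab; ring.
have ea k y : principal eta (e ^+ k * y) -> principal eta y.
  elim: k => [|k IH]; first by rewrite expr0 mul1r.
  by rewrite exprS -mulrA => /e_reg.
have [d dE] : principal eta (e ^+ (b - a) - 1).
  by apply: (ea a); exists c; rewrite -cE mulrBr mulr1 -exprD subnKC// ltnW.
exists (e ^+ (b - a).-1), d; rewrite -exprS prednK ?subn_gt0//.
by rewrite [eta * d]mulrC -dE addrC subrK.
Qed.

(** If v x < f, then x pi ^ (f - v x) has valuation f, so it equals e eta with v e = 0. Such an e is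
    invertible only modulo eta, whence the correction by a multiple of eta ^ 2. *)
Lemma adic_uniformizing (xs : seq A) :
  (forall x, exists2 i, (i < size xs)%N & principal eta (x - xs`_i)) ->
  exists pi : A, principal eta (pi ^+ f) /\
    forall x, principal eta x \/
      exists k y b, x * y * pi ^+ k.+1 = eta + eta * eta * b.
Proof.
move=> xsP; have [pi pi0 vpi] := adic_uniformizer.
have piX k : ((pi ^+ k : A) : F) = (pi : F) ^+ k.
  exact: (rmorphXn (\val : {rmorphism A -> F})).
have vX k : v ((pi ^+ k : A) : F) = k%:Z.
  by rewrite piX (place_exp _ _ (val_neq0 pi0)) vpi natz.
have X0 k : ((pi ^+ k : A) : F) != 0.
  by rewrite piX expf_neq0// val_neq0.
exists pi; split=> [|x].
  by apply/adic_principal; rewrite /place_ge vX lexx orbT.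
have [xeta|] := boolP (place_ge v f%:Z x); first by left; apply/adic_principal.
rewrite /place_ge negb_or -ltNge => /andP[x0 vx]; right.
have v0 := adic_ge0 x; pose k := (f - `|v x|%N)%N.
have [e eE] : principal eta (x * pi ^+ k.-1.+1).
  apply/adic_principal; rewrite /place_ge /= (pvalM v x0 (X0 _)) vX.
  by apply/orP; right; rewrite /k; lia.
have e0 : e != 0.
  apply: contraTneq x0 => e0; have := congr1 (fun a : A => (a : F)) eE.
  rewrite e0 mul0r /= => /eqP.
  by rewrite mulf_eq0 (negPf (X0 _)) orbF negbK.
have ve : v e = 0.
  have := congr1 (fun a : A => v a) eE; rewrite /= (pvalM v x0 (X0 _)).
  rewrite (pvalM v (val_neq0 e0) (val_neq0 eta0)) vX.
  by rewrite adic_eta /k; lia.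
have [e' [b eb]] := adic_unit_mod xsP ve e0.
exists k.-1, e', b; rewrite mulrAC eE.
by transitivity (e * e' * eta); [ring|rewrite eb; ring].
Qed.

End AdicPlace.

Lemma integral_absv_le1 (R : realType) (C : naFieldType R) (q : {poly C}) x :
  q \is monic -> (forall i, absv q`_i <= 1) -> root q x -> absv x <= 1.
Proof.
move=> qm q1 xq; rewrite leNgt; apply/negP => x1.
have := monic_neq0 qm; rewrite -size_poly_gt0 => sq.
move/rootP: xq; move: qm; rewrite horner_coef monicE lead_coefE.
case: (size q) sq => // n _ /= /eqP qn; rewrite big_ord_recr /= qn mul1r.
move/eqP; rewrite addrC addr_eq0 => /eqP/(congr1 (@absv R C)); rewrite absvN absvX.
apply/eqP; rewrite gt_eqF//; case: n {qn} => [|n].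
  by rewrite big_ord0 absv0 expr0 ltr01.
apply: (@le_lt_trans _ _ (absv x ^+ n)); last by rewrite ltr_eXn2l.
apply: absv_sum_le => [|i _]; first by rewrite exprn_ge0// absv_ge0.
rewrite absvM absvX -[leRHS]mul1r; apply: ler_pM; rewrite ?absv_ge0 ?exprn_ge0 ?absv_ge0//.
by apply: ler_weXn2l; [exact: ltW|rewrite -ltnS].
Qed.

Lemma poly_lift (L C : fieldType) (j : {rmorphism L -> C}) (q : {poly C}) :
  (forall i, exists x, j x = q`_i) -> exists p, map_poly j p = q.
Proof.
move=> /choice[x xE]; exists (\poly_(i < size q) x i).
apply/polyP => i; rewrite coef_map coef_poly; case: ltnP => iq; first exact: xE.
by rewrite /= rmorph0 nth_default.
Qed.

Lemma closed_absv_dense (R : realType) (L C : naFieldType R) (j : {rmorphism L -> C}) :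
  GRing.closed_field_axiom L -> (forall x, absv (j x) = absv x) ->
  (exists c : L, 0 < absv c < 1) -> forall (t : R) n, t < 1 -> (0 < n)%N ->
  exists x : C, 0 < absv x < 1 /\ t < absv x ^+ n.
Proof.
move=> L_closed jE [c /andP[c0 c1]] t n t1 n0.
pose s := Num.max t 0; have s1 : 0 <= s < 1 by rewrite le_max lexx orbT gt_max t1 ltr01.
have [N sN] := geometric_null 1 s1 c0.
have := sN N.+1 (leqnSn _); rewrite mul1r => {}sN.
have nN : (0 < n * N.+1)%N by rewrite muln_gt0 n0.
(* A root of c of order n (N + 1): then |x| ^ n is the root of order N + 1 of |c|, which exceeds s
   because s ^ (N + 1) < |c|. *)
have [x xE] := L_closed _ (fun i => if i is 0%N then c else 0) nN.
have {}xE : x ^+ (n * N.+1) = c.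
  rewrite xE -(prednK nN) big_ord_recl big1 ?addr0 ?expr0 ?mulr1// => i _.
  by rewrite mul0r.
have axE : (absv x ^+ n) ^+ N.+1 = absv c by rewrite -exprM -absvX xE.
exists (j x); rewrite jE; split.
  have x0 : absv x != 0.
    rewrite absv_eq0; apply: contraTneq c0 => x0.
    by rewrite -xE x0 expr0n gtn_eqF// absv0 ltxx.
  rewrite lt_neqAle eq_sym x0 absv_ge0 ltNge; apply/negP => x1.
  by move: c1; rewrite -axE -exprM ltNge exprn_ege1.
rewrite ltNge; apply/negP => xt; move: sN; rewrite -axE ltNge lerXn2r//.
- by rewrite nnegrE exprn_ge0// absv_ge0.
- by rewrite nnegrE; case/andP : s1.
- by rewrite (le_trans xt)// le_max lexx.
Qed.

(** * The operators of the Drinfeld module *)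

Theorem theorem7 (R : realType)
  (* the global function field F, with field of constants Fq, and the place oo *)
  (Fq : finFieldType) (F : fieldExtType {fraction {poly Fq}})
  (F_const : exact_constants F)
  (oo : place F)
  (* the completion of F at oo, its residue field koo and the sign function *)
  (Foo : naFieldType R) (jFoo : {rmorphism F -> Foo})
  (Foo_compl : is_completion (place_abs R #|Fq| oo) jFoo)
  (koo : finFieldType) (red : Foo -> koo) (redP : is_residue_map red)
  (teich : {rmorphism koo -> Foo}) (teichP : is_residue_section red teich)
  (sgn : Foo -> koo) (sgnP : is_sign_function teich sgn)
  (* gamma in Gal(koo / Fq) *)
  (gamma : {rmorphism koo -> koo})
  (gammaP : forall c : Fq,
     gamma (red (jFoo (constF F c))) = red (jFoo (constF F c)))
  (* the normalizing field H, containing koo, and the module Phi *)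
  (H : fieldExtType F) (jkoo : {rmorphism koo -> H})
  (jkooP : forall c : Fq, jkoo (red (jFoo (constF F c))) = (constF F c)%:A)
  (Phi : ringA oo -> {poly H})
  (PhiP : is_sgn_normalized #|Fq|
            (fun a : ringA oo => jkoo (gamma (sgn (jFoo (val a))))) Phi)
  (H_gen : forall E : {subfield H},
     (forall (a : ringA oo) (i : nat), (Phi a)`_i \in E) ->
     (E : {vspace H}) = fullv)
  (* the prime P of A, the completion of F at P, and C_P *)
  (P : prime_idealr (ringA oo)) (P_neq0 : exists2 a : ringA oo, a \in P & a != 0)
  (vP : place F) (vP_adic : is_adic_place [set` P] vP)
  (FP : naFieldType R) (jFP : {rmorphism F -> FP})
  (FP_compl : is_completion (place_abs R #|Fq| vP) jFP)
  (FPbar : naFieldType R) (jbar : {rmorphism FP -> FPbar})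
  (FPbar_closure : is_algebraic_closure jbar)
  (CP : naFieldType R) (jCP : {rmorphism FPbar -> CP})
  (CP_compl : is_completion (fun x : FPbar => absv x) jCP)
  (* the embedding of H in C_P, the closure K of H, and f, eta *)
  (iH : {rmorphism H -> CP}) (iHP : forall x : F, iH x%:A = jCP (jbar (jFP x)))
  (K : fieldType) (iK : {rmorphism K -> CP})
  (K_closure : range iK = closure (range iH))
  (f : nat) (f_deg : has_degree (fun x : FP => jCP (jbar x)) iK f)
  (eta : ringA oo) (eta_gen : ideal_exp [set` P] f = principal eta)
  (eta_sgn : sgn (jFoo (val eta)) = 1) :
  let Phi_eta := map_poly iH (tau_poly #|Fq| (Phi eta)) in
  let Phi_Pf := torsion #|Fq| iH Phi (ideal_exp [set` P] f) in
  exists T N : laurent iK -> laurent iK,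
    [/\ unique (fun T => continuous T /\ is_trace_operator Phi_eta Phi_Pf T) T,
        unique (fun N => continuous N /\ is_norm_operator Phi_eta Phi_Pf N) N,
        {morph T : g h / g + h},
        {in GRing.unit, forall g, N g \is a GRing.unit} &
        {in GRing.unit &, {morph N : g h / g * h}}].
Proof.
move=> Phi_eta Phi_Pf; set q := #|Fq|.
have q_gt1 : (1 < q)%N by exact: finNzRing_gt1.
have qC : [pchar CP].-nat q.
  have [p p_pr pF] := finPcharP Fq; rewrite /q (card_pprimeChar pF) pnatX.
  apply/orP; left; rewrite pnatE//.
  apply: (rmorph_pchar iH); apply: (rmorph_pchar (in_alg H)).
  apply: (rmorph_pchar (in_alg F)); apply: (rmorph_pchar (@tofrac {poly Fq})).
  exact: (rmorph_pchar (@polyC Fq)).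
have [jCP_abs CP_dense CP_complete] := CP_compl.
have [FPbar_closed _ jbar_abs] := FPbar_closure.
have [jFP_abs _ _] := FP_compl.
have absA (b : ringA oo) : absv (iH (val b)%:A) = place_abs R q vP b.
  by rewrite iHP jCP_abs jbar_abs jFP_abs.
have eta0 : eta != 0.
  apply: contra_eq_neq eta_sgn => ->.
  by rewrite /= rmorph0 (sgn0 sgnP) eq_sym oner_neq0.
(* An empty basis would give 1 = 0. *)
have f_gt0 : (0 < f)%N.
  case: f f_deg {eta_gen} @Phi_Pf => // -[e eP].
  have [c [/eqP + _]] := eP 1.
  by rewrite rmorph1 big_ord0 oner_eq0.
have q0 : (0 : R) < q%:R by rewrite ltr0n ltnW.
have absA_le1 (b : ringA oo) : absv (iH (val b)%:A) <= 1.
  rewrite absA /place_abs; case: ifP => // _; have := adic_ge0 vP_adic b.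
  case: (vP b) => // n _; rewrite -exprnN invf_le1 ?exprn_gt0// exprn_ege1//.
  by rewrite ler1n ltnW.
have abs_eta : 0 < absv (iH (val eta)%:A) < 1.
  rewrite absA /place_abs ifF; last first.
    by apply: contra_neqF eta0 => /eqP e; apply/val_inj.
  rewrite (adic_eta vP_adic f_gt0 eta0 eta_gen) -exprnN invr_gt0 exprn_gt0//=.
  by rewrite invf_lt1 ?exprn_gt0// exprn_egt1 ?ltr1n// -lt0n.
have Phi_abs a i : absv (iH (Phi a)`_i) <= 1.
  have [p pm] := Phi_integral PhiP a i.
  rewrite -[map_poly _ p]/(map_poly (in_alg H \o (\val : {rmorphism ringA oo -> F})) p).
  rewrite -(fmorph_root iH) => pr; apply: integral_absv_le1 pr => [|k].
    by rewrite !monic_map.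
  by rewrite !coef_map; exact: absA_le1.
have Phi_eta_monic : Phi eta \is monic.
  by rewrite monicE (Phi_lead PhiP)// eta_sgn !rmorph1.
have psi_monic : Phi_eta \is monic by rewrite map_monic tau_poly_monic.
(* [H] is algebraic over [F], so [iH] takes its values in the image of [FPbar], where [Phi_eta]
   splits. *)
have H_FPbar h : exists x, jCP x = iH h.
  have [/polyOver1P[p pE] pm] := (minPolyOver 1 h, monic_minPoly 1 h).
  have pr : root (map_poly (in_alg H) p) h by rewrite -pE root_minPoly.
  rewrite pE map_monic in pm.
  have [s sE] : exists s, map_poly (jbar \o jFP) p = \prod_(a <- s) ('X - a%:P).
    by apply: closed_field_split => //; rewrite map_monic.
  have : root (map_poly jCP (map_poly (jbar \o jFP) p)) (iH h).
    rewrite (_ : map_poly jCP _ = map_poly iH (map_poly (in_alg H) p)) ?fmorph_root//.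
    by apply/polyP => i; rewrite !coef_map/= iHP.
  rewrite sE rmorph_prod /root horner_prod prodf_seq_eq0 => /hasP[a _ /=].
  by rewrite rmorphB /= map_polyX map_polyC hornerXsubC subr_eq0 => /eqP ->; exists a.
have [r rE] : exists r, map_poly jCP r = Phi_eta.
  by apply: poly_lift => i; rewrite coef_map; exact: H_FPbar.
have [s sE] : exists s, r = \prod_(a <- s) ('X - a%:P).
  by apply: closed_field_split => //; rewrite -(map_monic jCP) rE.
pose V := map jCP s.
have VE : Phi_eta = \prod_(u <- V) ('X - u%:P).
  rewrite -rE sE rmorph_prod /V big_map; apply: eq_bigr => a _.
  by rewrite rmorphB /= map_polyX map_polyC.
pose act a z := tau_eval q iH (Phi a) z.
have psiE z : Phi_eta.[z] = act eta z by [].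
have VP u : (u \in V) = (act eta u == 0) by rewrite -psiE -rootE VE root_prod_XsubC.
have psiD x y : Phi_eta.[x + y] = Phi_eta.[x] + Phi_eta.[y] by exact: tau_evalD.
have act_mul a b z : act (a * b) z = act a (act b z).
  by rewrite /act (PhiM PhiP) tau_eval_mul.
have act_lt1 a z : absv z < 1 -> absv (act a z) < 1.
  move=> z1; apply: (le_lt_trans _ z1).
  rewrite /act (tau_evalE q iH (n := size (Phi a)))//.
  apply: absv_sum_le => [|i _]; first exact: absv_ge0.
  rewrite absvM absvX -[leRHS]mul1r; apply: ler_pM; rewrite ?exprn_ge0 ?absv_ge0//.
  have : (0 < q ^ i)%N by rewrite expn_gt0 (ltnW q_gt1).
  case: (q ^ i)%N => // n _; rewrite exprS ler_piMr ?absv_ge0//.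
  by rewrite exprn_ile1 ?absv_ge0// ltW.
have V0 : 0 \in V by rewrite VP /act tau_eval0.
have psi_deriv : Phi_eta^`() = (iH (val eta)%:A)%:P.
  by rewrite tau_poly_deriv// (Phi_coef0 PhiP).
have V_uniq : uniq V.
  rewrite -separable_prod_XsubC -VE separable_poly.unlock psi_deriv -alg_polyC.
  by rewrite coprimepZr ?coprimep1// absv_neq0//; case/andP : abs_eta.
have V_size : size V = (q ^ (size (Phi eta)).-1)%N.
  have := tau_poly_size q_gt1 (monic_neq0 Phi_eta_monic).
  by rewrite -(size_map_poly iH) -/Phi_eta VE size_prod_XsubC => -[].
have torsionE : Phi_Pf = [set` V].
  rewrite /Phi_Pf eta_gen; apply/seteqP; split => z /= => [zt|].
    by rewrite VP; have /rootP/eqP := zt eta (ex_intro _ 1 (esym (mul1r _))).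
  rewrite VP => /eqP z0 a [b ->]; apply/rootP.
  by rewrite -[LHS]/(act (b * eta) z) act_mul z0 /act tau_eval0.
(* The derivative of [Phi_eta] at 0 is both eta, of absolute value below 1, and the product of the
   -u over the nonzero u in [V]; these cannot all have absolute value at least 1. *)
have [u uV /andP[u0 u1]] : exists2 u, u \in V & 0 < absv u < 1.
  pose G := \prod_(u <- rem 0 V) ('X - u%:P).
  have psiG : Phi_eta = 'X * G by rewrite VE (big_rem 0 V0)/= subr0.
  have G0 : absv G.[0] = absv (iH (val eta)%:A).
    have := congr1 (fun h => h.[0]) psi_deriv.
    by rewrite /= psiG derivM derivX !hornerE ?mul0r ?addr0 => ->.
  apply/not_exists2P => V1; case/andP : abs_eta => _; rewrite -G0.
  apply/negP; rewrite -leNgt horner_prod absv_prod big_seq.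
  apply: (big_ind (fun x : R => 1 <= x)) => [//|x y x1 y1|u uV].
    exact: mulr_ege1.
  rewrite hornerXsubC sub0r absvN leNgt; apply/negP => u1.
  move: uV; rewrite mem_rem_uniq// inE => /andP[u0 uV].
  by have [//|/negP] := V1 u; rewrite absv_gt0 u0 u1.
(* As an element of [V], u comes from [FPbar], so [small_preimage] applies and its bound forces |m|
   < 1. *)
have [m m1 mu] : exists2 m, absv m < 1 & act eta m = u.
  case/mapP : uV => a _ uE.
  have [|z [za zle]] := @small_preimage R FPbar CP jCP FPbar_closed r V _ V0 a.
    by rewrite rE.
  exists (jCP z); last by rewrite -psiE -rE horner_map za uE.
  rewrite ltNge; apply/negP => z1; move: u1; rewrite uE ltNge.
  by rewrite (le_trans _ zle)// exprn_ege1.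
have [xs [xs_size xs_incong xs_cover]] := residue_reps (Phi_rank1 PhiP eta0).
have [pi [pi_nil pi_unif]] := adic_uniformizing vP_adic f_gt0 eta0 eta_gen xs_cover.
have V_lt1 w : w \in V -> absv w < 1.
  apply: (@torsion_lt1 R CP (ringA oo) act eta pi V xs f
    _ _ act_mul act_lt1 VP _ xs_incong pi_nil pi_unif m) => //.
  - by move=> a x y; exact: tau_evalD.
  - by move=> a b x; rewrite /act (PhiD PhiP) tau_eval_add.
  - by rewrite V_size xs_size.
  - by rewrite mu absv_neq0.
  - by apply/eqP; rewrite mu -VP.
have psi_surj w : absv w < 1 -> exists2 z, absv z < 1 & Phi_eta.[z] = w.
  rewrite -rE.
  apply: (additive_surjective FPbar_closed CP_dense CP_complete (V := V)) => //.
    by rewrite rE.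
  by move=> x y; rewrite rE.
have small : exists x : CP, 0 < absv x < 1 by exists u; rewrite u0.
have absv_dense : forall (t : R) n, t < 1 -> (0 < n)%N ->
    exists x : CP, 0 < absv x < 1 /\ t < absv x ^+ n.
  apply: (closed_absv_dense FPbar_closed jCP_abs).
  have [x xE] := H_FPbar (val eta)%:A.
  by exists x; rewrite -jCP_abs xE.
have [p pE] : exists p, map_poly iK p = Phi_eta.
  apply: poly_lift => i; rewrite coef_map.
  have : range iK (iH (tau_poly q (Phi eta))`_i).
    by rewrite K_closure; apply: subset_closure; exists (tau_poly q (Phi eta))`_i.
  by move=> [x _ xE]; exists x.
(* The image of [K] is a closure, hence closed in [CP]. *)
have K_closed (k : nat -> K) (l : CP) : (iK \o k) @ \oo --> l -> exists x, iK x = l.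
  move=> kl; suff : range iK l by move=> [x _ <-]; exists x.
  rewrite K_closure; apply: (closed_cvg (closure (range iH))) kl.
    exact: closed_closure.
  by apply: nearW => n; rewrite -K_closure; exists (k n).
rewrite torsionE; apply: trace_norm_operators => // g.
have := @trace_norm_exist R K CP iK CP_complete K_closed absv_dense p V.
by rewrite pE; apply.
Qed.
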